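(* Let $(x,a,p,s)\in\mathbb{C}^4$. Then the following are equivalent: \begin{enumerate} \item $(x,a,p,s)\in\partial_s\mathbb{F}$; \item there exist real numbers $\theta,x_1,x_2,x_3,x_4$ with $x_1^2+x_2^2+x_3^2+x_4^2=1$ such that \[ (x,a,p,s)=\left(e^{i\theta}(x_3+ix_4),\ -e^{i\theta}(x_3-ix_4),\ -e^{2i\theta},\ 2e^{i\theta}x_2\right); \] \item there exist $(z,w)\in\overline{\mathbb{B}}_2$ and $\eta\in\mathbb{T}$ such that $(x,a,p,s)=\left(\overline{z},\,-\eta z,\,-\eta,\,w+\overline{w}\eta\right)$; \item $(x,a,p)\in b\mathbb{E}$ and there exists $w\in\mathbb{C}$ such that $(x,w)\in\overline{\mathbb{B}}_2$ and $s=w-\overline{w}p$. \end{enumerate}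
   Context: $\mathbb{T}$ is the unit circle in $\mathbb{C}$; $\overline{\mathbb{B}}_2=\{(z,w)\in\mathbb{C}^2:|z|^2+|w|^2\le 1\}$; $M_2(\mathbb{C})$ is the space of $2\times 2$ complex matrices and $\|A\|$ is the operator norm of $A$. The domain $\mathbb{F}$ is \[ \mathbb{F}=\{(a_{11},a_{22},\det(A),a_{12}+a_{21})\in\mathbb{C}^4 : A=(a_{ij})_{i,j=1}^2\in M_2(\mathbb{C}),\ \|A\|<1\}. \] The tetrablock is $\mathbb{E}=\{(x_1,x_2,x_3)\in\mathbb{C}^3 : 1-x_1z_1-x_2z_2+x_3z_1z_2\neq 0 \text{ for all } |z_1|\le 1,\ |z_2|\le 1\}$. For a bounded domain $\Omega\subset\mathbb{C}^n$, $A(\Omega)$ denotes the algebra of continuous functions on $\overline{\Omega}$ that are holomorphic in $\Omega$; the distinguished (Shilov) boundary of $\Omega$, denoted $b\Omega$ or $\partial_s\Omega$, is the smallest closed subset of $\overline{\Omega}$ on which every function in $A(\Omega)$ attains its maximum modulus. *)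

(* Defs.v *)
From HB Require Import structures.
From mathcomp Require Export all_boot all_order all_algebra.
From mathcomp Require Export all_classical all_reals all_analysis.
From mathcomp Require Export complex.
Export Order.TTheory GRing.Theory Num.Theory.
Export numFieldNormedType.Exports.

Set Implicit Arguments.
Unset Strict Implicit.
Unset Printing Implicit Defensive.

Local Open Scope classical_set_scope.
Local Open Scope ring_scope.

(* The alias R[i]^o carries the normed-module structure of R[i] over itself;
   C^n is an iterated product of copies of it. *)
Notation CC R := (R[i]^o)%type.
Notation C3 R := (CC R * CC R * CC R)%type.
Notation C4 R := (CC R * CC R * CC R * CC R)%type.

Section ShilovBoundary.
Variables (R : realType) (V : normedModType R[i]).
Implicit Types (Omega B : set V) (f : V -> CC R).

(* Differentiability is over the scalar field R[i]: the differential is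
   complex linear.  Values of f outside the closure of Omega are irrelevant
   when Omega is open. *)
Definition holomorphic_in Omega f := forall z, Omega z -> differentiable f z.

Definition algebra_A Omega : set (V -> CC R) :=
  [set f | {within closure Omega, continuous f} /\ holomorphic_in Omega f].

Definition closed_boundary Omega B :=
  [/\ closed B, B `<=` closure Omega &
      forall f, algebra_A Omega f ->
        exists2 z, B z & forall y, closure Omega y -> `|f y| <= `|f z|].

Definition is_shilov_boundary Omega B :=
  closed_boundary Omega B /\
  forall B', closed_boundary Omega B' -> B `<=` B'.

(* The set characterised by is_shilov_boundary, which is unique; membership
   asserts in particular that a smallest closed boundary exists. *)
Definition shilov_boundary Omega : set V :=
  [set z | exists2 B, is_shilov_boundary Omega B & B z].

End ShilovBoundary.

Section Domains.
Variable R : realType.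

Definition l2norm n (v : 'cV[R[i]]_n) : R :=
  Num.sqrt (\sum_(i < n) ComplexField.Normc.normc (v i 0) ^+ 2).

Definition opnorm n (A : 'M[R[i]]_n) : R :=
  sup [set l2norm (A *m v) | v in [set v | l2norm v <= 1]].

Definition domainF : set (C4 R) :=
  [set (A 0 0, A 1 1, \det A, A 0 1 + A 1 0)
     | A in [set A : 'M[R[i]]_2 | opnorm A < 1]].

Definition tetrablock : set (C3 R) :=
  [set u | let: (x1, x2, x3) := u in
     forall z1 z2 : R[i], `|z1| <= 1 -> `|z2| <= 1 ->
       1 - x1 * z1 - x2 * z2 + x3 * z1 * z2 != 0].

Definition cball2 : set (R[i] * R[i]) :=
  [set u | `|u.1| ^+ 2 + `|u.2| ^+ 2 <= 1].

Definition expi (theta : R) : R[i] := (cos theta +i* sin theta)%C.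

End Domains.

(* Main.v *)
(** Both domains are images of the ball of strict contractions
    [A = (a11, a12; a21, a22)], the tetrablock under [(a11, a22, det A)] and [F]
    under [(a11, a22, det A, a12 + a21)], and both distinguished boundaries are
    the images of the unitary matrices.

    Maximum principle: through a contraction [A] that is not unitary passes a
    complex line whose points near [A] are contractions.  Hence for [g]
    holomorphic a maximum point of [|g| + e |A|^2] over the contractions
    (Frobenius norm) is unitary, for otherwise the mean value inequality for the
    real part of [g], corrected by a linear function, fails on that line.  The
    mean value inequality itself comes from Goursat's bisection argument applied
    in polar coordinates.

    Minimality: every point of the boundary of the tetrablock is a peak point of
    a quadratic polynomial.  For the class in [F] of a unitary [U], which only
    remembers the unordered pair of [U] and its transpose, the function
    [g = (2 + tr (U^* A)) / 4] on matrices peaks at [U], and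
    [A |-> g(A)^n + g(A^T)^n] descends to a polynomial on [F] that peaks at the
    class of [U] up to an exponentially small error. *)
Require Import Defs.
From mathcomp Require Import ring lra.

Set Implicit Arguments.
Unset Strict Implicit.
Unset Printing Implicit Defensive.

Import ComplexField.Normc.

Local Open Scope classical_set_scope.
Local Open Scope ring_scope.

(** [holomorphic_in] asks only for complex differentiability at each point, with no continuity of
    the derivative; hence Goursat. Polar coordinates make circles into sides of rectangles, and
    periodicity cancels the two remaining sides.

    A function of the algebra is differentiable only over the open domain. The maximum principle is
    therefore run for [A |-> g (r A)] with [r < 1], and [r] tends to [1] uniformly on the compact
    set of unitary matrices. The penalty is there because [|g|] may be constant along a line; it is
    at most [2 e] on contractions and disappears with [e].

    On F a unitary [U] and its transpose have the same image, so [tr (U^* A)] does not descend, and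
    its symmetrization sees only the symmetric part of [U]: it vanishes when [U] is antisymmetric.
    High powers separate the two factors. The shift by [2] in the peaking function does two things:
    modulus [1] then forces the trace to equal [2] and not merely to have modulus [2], and the value
    at the transpose of [U] becomes a nonnegative real, so that the two powers cannot cancel at
    [U]. *)

Local Notation Re := (@complex.Re _).
Local Notation Im := (@complex.Im _).
Local Notation "A '`11'" := (A.1.1.1 : CC _) (at level 1, format "A '`11'").
Local Notation "A '`12'" := (A.1.1.2 : CC _) (at level 1, format "A '`12'").
Local Notation "A '`21'" := (A.1.2 : CC _) (at level 1, format "A '`21'").
Local Notation "A '`22'" := (A.2 : CC _) (at level 1, format "A '`22'").

(** * Divergence theorem on rectangles *)

Section Segment.
Variable R : realType.
Implicit Types (f g : R -> R) (a b m k : R).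
Notation mu := (@lebesgue_measure R).

Definition cont_seg f a b := forall x, a <= x <= b -> {for x, continuous f}.

Definition seg_int f a b : R := \int[mu]_(x in `[a, b]) f x.

Lemma cont_segS f a b a' b' : cont_seg f a b -> a <= a' -> b' <= b ->
  cont_seg f a' b'.
Proof.
move=> cf aa bb x /andP[h1 h2]; apply: cf.
by rewrite (le_trans aa h1) (le_trans h2 bb).
Qed.

Lemma cont_segB f g a b : cont_seg f a b -> cont_seg g a b ->
  cont_seg (fun x => f x - g x) a b.
Proof. by move=> cf cg x xab; apply: continuousB; [exact: cf|exact: cg]. Qed.

Lemma cont_seg_cst k a b : cont_seg (fun=> k) a b.
Proof. by move=> x _; exact: cst_continuous. Qed.

Lemma cont_seg_integrable f a b : cont_seg f a b ->
  mu.-integrable `[a, b] (EFin \o f).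
Proof.
move=> cf; apply: continuous_compact_integrable; first exact: segment_compact.
apply: continuous_in_subspaceT => x; rewrite inE/= in_itv/=; exact: cf.
Qed.

Lemma seg_int_cst k a b : a <= b -> seg_int (fun=> k) a b = k * (b - a).
Proof.
move=> ab; rewrite /seg_int Rintegral_cst//= lebesgue_measure_itv/= lte_fin.
by rewrite lt_neqAle ab andbT; case: eqVneq => [->|_]/=; rewrite ?subrr.
Qed.

Lemma seg_intD f g a b : cont_seg f a b -> cont_seg g a b ->
  seg_int (fun x => f x + g x) a b = seg_int f a b + seg_int g a b.
Proof. by move=> cf cg; apply: RintegralD => //; exact: cont_seg_integrable. Qed.

Lemma seg_int_le f g a b : cont_seg f a b -> cont_seg g a b ->
  (forall x, a <= x <= b -> f x <= g x) -> seg_int f a b <= seg_int g a b.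
Proof.
move=> cf cg fg; apply: le_Rintegral => //; try exact: cont_seg_integrable.
Qed.

Lemma seg_int_cat f a m b : cont_seg f a b -> a <= m -> m <= b ->
  seg_int f a b = seg_int f a m + seg_int f m b.
Proof.
move=> cf am mb.
have := @Rintegral_itvB R f (BLeft a) (BRight b) m (cont_seg_integrable cf).
rewrite !bnd_simp => /(_ am mb) h.
rewrite /seg_int -(@Rintegral_itv_obnd_cbnd _ m (BRight b)) -?h; first by ring.
apply: integrableS (cont_seg_integrable cf) => //.
by apply: subset_itvr; rewrite bnd_simp.
Qed.

Lemma eq_seg_int f g a b : (forall x, a <= x <= b -> f x = g x) ->
  seg_int f a b = seg_int g a b.
Proof.
by move=> fg; apply: eq_Rintegral => x; rewrite inE/= in_itv; exact: fg.
Qed.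

Lemma seg_int_near_cst f k e a b : a <= b -> cont_seg f a b ->
  (forall x, a <= x <= b -> `|f x - k| <= e) ->
  `|seg_int f a b - k * (b - a)| <= e * (b - a).
Proof.
move=> ab cf fk; have cst := cont_seg_cst.
have h1 : seg_int f a b <= (k + e) * (b - a).
  rewrite -seg_int_cst//; apply: seg_int_le => // x /fk.
  by rewrite ler_norml => /andP[]; lra.
have h2 : (k - e) * (b - a) <= seg_int f a b.
  rewrite -seg_int_cst//; apply: seg_int_le => // x /fk.
  by rewrite ler_norml => /andP[]; lra.
by rewrite ler_norml; apply/andP; split; lra.
Qed.

Lemma nested_segments (a b : nat -> R) :
  (forall n, a n <= a n.+1) -> (forall n, b n.+1 <= b n) ->
  (forall n, a n <= b n) -> exists x, forall n, a n <= x <= b n.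
Proof.
move=> ia db ab.
have ia' (m n : nat) : (m <= n)%N -> a m <= a n.
  by move=> /subnK <-; elim: (n - m)%N => // k IH; exact: le_trans IH (ia _).
have db' (m n : nat) : (m <= n)%N -> b n <= b m.
  by move=> /subnK <-; elim: (n - m)%N => // k IH; exact: le_trans (db _) IH.
have akb (k n : nat) : a k <= b n.
  apply: le_trans (ia' _ _ (leq_maxl k n)) _.
  exact: le_trans (ab _) (db' _ _ (leq_maxr k n)).
exists (sup (range a)) => n; apply/andP; split.
  apply: sup_upper_bound; last by exists n.
  by split; [exists (a 0%N); exists 0%N|exists (b 0%N) => _ [k _ <-]].
apply: ge_sup; first by exists (a 0%N); exists 0%N.
by move=> _ [k _ <-].
Qed.

End Segment.

Section Green.
Variables (R : realType) (U V : R -> R -> R).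

(** Outward flux of the field [(U, V)] through the boundary of [[a, b] x [c, d]]; opposite sides
    share one integral, so only increments of [U] and [V] enter. *)
Definition flux (a b c d : R) : R :=
  seg_int (fun y => U b y - U a y) c d + seg_int (fun x => V x d - V x c) a b.

(* Pointwise form of [dU/dx + dV/dy = 0]: the two increments are compared at
   points that need not be aligned with [(x0, y0)]. *)
Definition divergence_free (x0 y0 : R) := exists p : R, forall e, 0 < e ->
  exists2 r, 0 < r & forall x x' y y', `|x - x0| <= r -> `|x' - x0| <= r ->
    `|y - y0| <= r -> `|y' - y0| <= r ->
    `|U x' y - U x y - p * (x' - x)|
        <= e * (`|x - x0| + `|x' - x0| + `|y - y0|) /\
    `|V x y' - V x y + p * (y' - y)|
        <= e * (`|x - x0| + `|y - y0| + `|y' - y0|).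

Definition cont_lines (a b c d : R) :=
  (forall x, a <= x <= b -> cont_seg (U x) c d) /\
  (forall y, c <= y <= d -> cont_seg (V ^~ y) a b).

Lemma cont_linesS a b c d a' b' c' d' : cont_lines a b c d ->
  a <= a' -> b' <= b -> c <= c' -> d' <= d -> cont_lines a' b' c' d'.
Proof.
move=> [h1 h2] aa bb cc dd; split=> [x /andP[x1 x2]|y /andP[y1 y2]].
  apply: (cont_segS (h1 x _) cc dd).
  by rewrite (le_trans aa x1) (le_trans x2 bb).
apply: (cont_segS (h2 y _) aa bb).
by rewrite (le_trans cc y1) (le_trans y2 dd).
Qed.

Lemma flux_splitx a m b c d : cont_lines a b c d -> a <= m -> m <= b ->
  c <= d -> flux a b c d = flux a m c d + flux m b c d.
Proof.
move=> [h1 h2] am mb cd; have ab := le_trans am mb.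
have ca : cont_seg (U a) c d by apply: h1; rewrite lexx.
have cb : cont_seg (U b) c d by apply: h1; rewrite lexx ab.
have cm : cont_seg (U m) c d by apply: h1; rewrite am mb.
rewrite /flux (seg_int_cat _ am mb); last first.
  by apply: cont_segB; apply: h2; rewrite lexx ?cd.
have -> : seg_int (fun y => U b y - U a y) c d =
    seg_int (fun y => U m y - U a y) c d + seg_int (fun y => U b y - U m y) c d.
  rewrite -seg_intD; try exact: cont_segB.
  by apply: eq_seg_int => x _; ring.
by ring.
Qed.

Lemma flux_splity a b c m d : cont_lines a b c d -> c <= m -> m <= d ->
  a <= b -> flux a b c d = flux a b c m + flux a b m d.
Proof.
move=> [h1 h2] cm md ab; have cd := le_trans cm md.
have cc : cont_seg (V ^~ c) a b by apply: h2; rewrite lexx.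
have ccd : cont_seg (V ^~ d) a b by apply: h2; rewrite lexx cd.
have ccm : cont_seg (V ^~ m) a b by apply: h2; rewrite cm md.
rewrite /flux (seg_int_cat _ cm md); last first.
  by apply: cont_segB; apply: h1; rewrite lexx ?ab.
have -> : seg_int (fun x => V x d - V x c) a b =
    seg_int (fun x => V x m - V x c) a b + seg_int (fun x => V x d - V x m) a b.
  rewrite -seg_intD; try exact: cont_segB.
  by apply: eq_seg_int => x _; ring.
by ring.
Qed.

(** On a small rectangle around the point the integrands are [p (b - a)] and [- p (d - c)] up to a
    small multiple of the half perimeter. The main terms integrate to plus and minus [p] times the
    area and cancel. *)
Lemma flux_small x0 y0 : divergence_free x0 y0 -> forall e, 0 < e ->
  exists2 r, 0 < r & forall a b c d, cont_lines a b c d ->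
    a <= x0 <= b -> c <= y0 <= d -> b - a <= r -> d - c <= r ->
    `|flux a b c d| <= e * (b - a + (d - c)) ^+ 2.
Proof.
move=> [p hp] e e0; have [|r r0 hr] := hp (e / 3); first by lra.
exists r => // a b c d [h1 h2] /andP[ax xb] /andP[cy yd] abr cdr.
have ab : a <= b := le_trans ax xb.
have cd : c <= d := le_trans cy yd.
have na : `|a - x0| = x0 - a by rewrite distrC ger0_norm// subr_ge0.
have nb : `|b - x0| = b - x0 by rewrite ger0_norm// subr_ge0.
have nc : `|c - y0| = y0 - c by rewrite distrC ger0_norm// subr_ge0.
have nd : `|d - y0| = d - y0 by rewrite ger0_norm// subr_ge0.
have ra : `|a - x0| <= r by rewrite na; clear -xb abr; lra.
have rb : `|b - x0| <= r by rewrite nb; clear -ax abr; lra.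
have rc : `|c - y0| <= r by rewrite nc; clear -yd cdr; lra.
have rd : `|d - y0| <= r by rewrite nd; clear -cy cdr; lra.
have e30 : 0 <= e / 3 by rewrite divr_ge0// ltW.
have k1 : `|seg_int (fun y => U b y - U a y) c d - p * (b - a) * (d - c)|
    <= e / 3 * (b - a + (d - c)) * (d - c).
  apply: seg_int_near_cst => //.
    by apply: cont_segB; apply: h1; rewrite lexx ab.
  move=> y /andP[y1 y2]; have ny : `|y - y0| <= d - c.
    by rewrite ler_norml; clear -cy yd y1 y2; lra.
  have [h _] := hr a b y c ra rb (le_trans ny cdr) rc.
  apply: le_trans h _; rewrite na nb; apply: ler_wpM2l => //.
  by clear -ny; lra.
have k2 : `|seg_int (fun x => V x d - V x c) a b - (- (p * (d - c))) * (b - a)|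
    <= e / 3 * (b - a + (d - c)) * (b - a).
  apply: seg_int_near_cst => //.
    by apply: cont_segB; apply: h2; rewrite lexx cd.
  move=> x /andP[x1 x2]; have nx : `|x - x0| <= b - a.
    by rewrite ler_norml; clear -ax xb x1 x2; lra.
  have [_ h] := hr x b c d (le_trans nx abr) rb rc rd.
  rewrite opprK; apply: le_trans h _; rewrite nc nd; apply: ler_wpM2l => //.
  by clear -nx; lra.
rewrite /flux; have := ler_normD
  (seg_int (fun y => U b y - U a y) c d - p * (b - a) * (d - c))
  (seg_int (fun x => V x d - V x c) a b - (- (p * (d - c))) * (b - a)).
set s1 := seg_int _ _ _; set s2 := seg_int _ _ _.
have -> : s1 - p * (b - a) * (d - c) + (s2 - - (p * (d - c)) * (b - a)) =
  s1 + s2 by ring.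
move=> k; apply: (le_trans k); apply: le_trans (lerD k1 k2) _.
have -> : e / 3 * (b - a + (d - c)) * (d - c) + e / 3 * (b - a + (d - c)) * (b - a)
   = e / 3 * (b - a + (d - c)) ^+ 2 by ring.
apply: ler_wpM2r; first exact: sqr_ge0.
by clear -e0; lra.
Qed.

Record rect := Rect { lft : R; rgt : R; bot : R; top : R }.
Definition rect_flux q := flux (lft q) (rgt q) (bot q) (top q).

Definition halvex q := let m := (lft q + rgt q) / 2 in
  let q1 := Rect (lft q) m (bot q) (top q) in
  if `|rect_flux q| <= 2 * `|rect_flux q1| then q1
  else Rect m (rgt q) (bot q) (top q).

Definition halvey q := let m := (bot q + top q) / 2 in
  let q1 := Rect (lft q) (rgt q) (bot q) m in
  if `|rect_flux q| <= 2 * `|rect_flux q1| then q1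
  else Rect (lft q) (rgt q) m (top q).

Definition rect_ok q := [/\ lft q <= rgt q, bot q <= top q &
  cont_lines (lft q) (rgt q) (bot q) (top q)].

Definition subrect q' q := [/\ lft q <= lft q', rgt q' <= rgt q,
  bot q <= bot q' & top q' <= top q].

Lemma halvexP q (q' := halvex q) : rect_ok q -> [/\ rect_ok q', subrect q' q,
  rgt q' - lft q' = (rgt q - lft q) / 2, top q' - bot q' = top q - bot q &
  `|rect_flux q| <= 2 * `|rect_flux q'|].
Proof.
case: q @q' => a b c d q' [/= ab cd cl]; rewrite {}/q'.
have am : a <= (a + b) / 2 by lra.
have mb : (a + b) / 2 <= b by lra.
rewrite /halvex/=; case: ifPn => [h|].
  have cl' : cont_lines a ((a + b) / 2) c d by exact: cont_linesS cl _ _ _ _.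
  by split=> //=; lra.
have cl' : cont_lines ((a + b) / 2) b c d by exact: cont_linesS cl _ _ _ _.
rewrite -ltNge => h; split=> //=; first lra.
move: h; rewrite /rect_flux/= (flux_splitx cl am mb cd).
set s := flux _ _ _ _; set t := flux _ _ _ _ => h.
have := ler_normD s t; lra.
Qed.

Lemma halveyP q (q' := halvey q) : rect_ok q -> [/\ rect_ok q', subrect q' q,
  rgt q' - lft q' = rgt q - lft q, top q' - bot q' = (top q - bot q) / 2 &
  `|rect_flux q| <= 2 * `|rect_flux q'|].
Proof.
case: q @q' => a b c d q' [/= ab cd cl]; rewrite {}/q'.
have am : c <= (c + d) / 2 by lra.
have mb : (c + d) / 2 <= d by lra.
rewrite /halvey/=; case: ifPn => [h|].
  have cl' : cont_lines a b c ((c + d) / 2) by exact: cont_linesS cl _ _ _ _.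
  by split=> //=; lra.
have cl' : cont_lines a b ((c + d) / 2) d by exact: cont_linesS cl _ _ _ _.
rewrite -ltNge => h; split=> //=; first lra.
move: h; rewrite /rect_flux/= (flux_splity cl am mb ab).
set s := flux _ _ _ _; set t := flux _ _ _ _ => h.
have := ler_normD s t; lra.
Qed.

Lemma exp2V_small (C e : R) : 0 < e -> exists n : nat, C / 2 ^+ n <= e.
Proof.
move=> e0.
exists (Num.bound (C / e)).
have h : C / e <= 2 ^+ Num.bound (C / e).
  apply: le_trans (ler_norm _) _.
  apply: le_trans (ltW (archi_boundP (normr_ge0 _))) _.
  have -> : Num.bound `|C / e| = Num.bound (C / e).
    by rewrite /Num.bound normr_id.
  rewrite -natrX ler_nat; exact/ltnW/ltn_expl.
rewrite ler_pdivrMr ?exprn_gt0//; move: h; rewrite ler_pdivrMr//; lra.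
Qed.

(* Goursat's bisection argument. *)
Lemma flux_eq0 a b c d : a <= b -> c <= d -> cont_lines a b c d ->
  (forall x y, a <= x <= b -> c <= y <= d -> divergence_free x y) ->
  flux a b c d = 0.
Proof.
move=> ab cd cl df; apply/eqP; rewrite -normr_eq0 eq_le normr_ge0 andbT.
pose q n := iter n (halvey \o halvex) (Rect a b c d).
have qS n : q n.+1 = halvey (halvex (q n)) by [].
have qok n : rect_ok (q n).
  elim: n => [|n IH]; first by split.
  by rewrite qS; have [/halveyP[]] := halvexP IH.
have qsub n : subrect (q n.+1) (q n).
  have [okx [s1 s2 s3 s4] _ _ _] := halvexP (qok n).
  have [_ [t1 t2 t3 t4] _ _ _] := halveyP okx.
  rewrite qS; split; [exact: le_trans s1 t1|exact: le_trans t2 s2|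
    exact: le_trans s3 t3|exact: le_trans t4 s4].
(* One round halves both sides. The flux loses at most a factor [4], and the bound of [flux_small],
   quadratic in the sides, loses exactly [4], so the bound scales back to the initial rectangle. *)
have qsize n : [/\ rgt (q n) - lft (q n) = (b - a) / 2 ^+ n,
    top (q n) - bot (q n) = (d - c) / 2 ^+ n &
    `|flux a b c d| <= 4 ^+ n * `|rect_flux (q n)|].
  elim: n => [|n [I1 I2 I3]]; first by rewrite /= !expr0 !divr1 mul1r.
  have [okx _ w1 w2 w3] := halvexP (qok n).
  have [_ _ v1 v2 v3] := halveyP okx.
  rewrite qS v1 v2 w1 w2 I1 I2 !exprS; split.
  - by field; rewrite expf_neq0.
  - by field; rewrite expf_neq0.
  - apply: (le_trans I3); rewrite (mulrC 4) -mulrA.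
    apply: ler_wpM2l; first by rewrite exprn_ge0.
    by lra.
have [x hx] : exists x, forall n, lft (q n) <= x <= rgt (q n).
  apply: nested_segments => n; [by case: (qsub n)|by case: (qsub n)|].
  by case: (qok n).
have [y hy] : exists y, forall n, bot (q n) <= y <= top (q n).
  apply: nested_segments => n; [by case: (qsub n)|by case: (qsub n)|].
  by case: (qok n).
have sm := flux_small (df x y (hx 0%N) (hy 0%N)).
apply/ler_addgt0Pr => e e0; rewrite add0r.
set T := (b - a + (d - c)) ^+ 2.
have T0 : 0 <= T by exact: sqr_ge0.
(* [T + 1] rather than [T], since [T] is zero when the rectangle is a point. *)
have [|r r0 hr] := sm (e / (T + 1)); first by rewrite divr_gt0//; lra.
have [n hn] := exp2V_small (b - a + (d - c)) r0.
have [w1 w2 w3] := qsize n.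
have p0 : 0 < (2 : R) ^+ n by rewrite exprn_gt0.
have hab : 0 <= (b - a) / 2 ^+ n by apply: divr_ge0; [rewrite subr_ge0|exact: ltW].
have hcd : 0 <= (d - c) / 2 ^+ n by apply: divr_ge0; [rewrite subr_ge0|exact: ltW].
have [_ _ cln] := qok n.
have := hr _ _ _ _ cln (hx n) (hy n).
rewrite w1 w2 -mulrDl.
move: hn; rewrite mulrDl => hn; rewrite -mulrDl => /(_ ltac:(lra) ltac:(lra)) k.
apply: (le_trans w3); rewrite /rect_flux.
apply: le_trans (ler_wpM2l _ k) _; first by rewrite exprn_ge0.
rewrite expr_div_n -/T.
have -> : (4 : R) ^+ n * (e / (T + 1) * (T / (2 ^+ n) ^+ 2)) = e * (T / (T + 1)).
  have -> : (4 : R) ^+ n = (2 ^+ n) ^+ 2.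
    by rewrite -exprM mulnC exprM; congr (_ ^+ _); ring.
  by field; rewrite expf_neq0// gt_eqF//; lra.
rewrite -[leRHS]mulr1 ler_wpM2l// ?(ltW e0)// ler_pdivrMr; lra.
Qed.

End Green.

(** * Mean value inequality *)

Lemma derivable_expansion (K : numFieldType) (f : K^o -> K^o) (x : K) :
  derivable f x 1 -> forall e : K, 0 < e -> exists2 r : K, 0 < r &
    forall y, `|y - x| <= r ->
      `|f y - f x - 'D_1 f x * (y - x)| <= e * `|y - x|.
Proof.
move=> fx e e0.
have /cvgrPdist_le/(_ e e0) := fx.
rewrite -/(derive f x 1) /= => /nbhs_ballP[r /= r0 hr].
exists (r / 2); first by rewrite divr_gt0.
move=> y yx; have [->|yNx] := eqVneq y x.
  by rewrite !subrr mulr0 subr0 normr0 mulr0.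
have y0 : y - x != 0 by rewrite subr_eq0.
have := hr (y - x); rewrite /ball/= sub0r normrN.
have lt : `|y - x| < r by rewrite (le_lt_trans yx)// ltr_pdivrMr// mulr_natr mulr2n ltrDl.
move=> /(_ lt y0).
rewrite [_ *: 1]mulr1 subrK => h.
have -> : f y - f x - 'D_1 f x * (y - x) =
    - (('D_1 f x - (y - x)^-1 * (f y - f x)) * (y - x)) by field.
by rewrite normrN normrM ler_wpM2r.
Qed.

Section Polar.
Variables (R : realType) (u v : R -> R -> R).

(** The differential of [(u, v)] is multiplication by [p + iq], so the Cauchy-Riemann equations are
    built in. *)
Definition cr_diff (x0 y0 : R) := exists p q : R, forall e, 0 < e ->
  exists2 r, 0 < r & forall x y, `|x - x0| <= r -> `|y - y0| <= r ->
    `|u x y - u x0 y0 - (p * (x - x0) - q * (y - y0))|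
        <= e * (`|x - x0| + `|y - y0|) /\
    `|v x y - v x0 y0 - (q * (x - x0) + p * (y - y0))|
        <= e * (`|x - x0| + `|y - y0|).

Lemma cr_diff_near x0 y0 : cr_diff x0 y0 -> forall e, 0 < e ->
  exists2 r, 0 < r & forall x y, `|x - x0| <= r -> `|y - y0| <= r ->
    `|u x y - u x0 y0| <= e /\ `|v x y - v x0 y0| <= e.
Proof.
move=> [p [q hpq]] e e0; have [r r0 hr] := hpq 1 ltr01.
pose C := `|p| + `|q| + 1.
have C0 : 0 < C by rewrite /C ltr_wpDl// addr_ge0.
have eC : 0 < e / C / 2 by rewrite !divr_gt0.
exists (Num.min r (e / C / 2)); first by rewrite lt_min r0.
move=> x y; rewrite !le_min => /andP[x1 x2] /andP[y1 y2].
have [h1 h2] := hr x y x1 y1.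
have bnd (a b s : R) : `|a| <= `|p| + `|q| -> `|b| <= `|p| + `|q| ->
    `|s - (a * (x - x0) + b * (y - y0))| <= 1 * (`|x - x0| + `|y - y0|) ->
    `|s| <= e.
  move=> ha hb hs.
  have t1 : `|a * (x - x0)| <= (`|p| + `|q|) * (e / C / 2).
    by rewrite normrM ler_pM.
  have t2 : `|b * (y - y0)| <= (`|p| + `|q|) * (e / C / 2).
    by rewrite normrM ler_pM.
  rewrite -(subrK (a * (x - x0) + b * (y - y0)) s).
  apply: le_trans (ler_normD _ _) _.
  apply: le_trans (lerD hs (ler_normD _ _)) _.
  have -> : e = (`|p| + `|q|) * (e / C / 2) + (`|p| + `|q|) * (e / C / 2)
     + 1 * (e / C / 2 + e / C / 2).
    have : C != 0 by rewrite gt_eqF.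
    by rewrite /C => ?; field.
  by rewrite addrC; apply: lerD; rewrite ?mul1r; apply: lerD.
split.
- apply: (bnd p (- q)); rewrite ?normrN ?lerDl ?lerDr//.
  by rewrite mulNr.
- by apply: (bnd q p); rewrite ?lerDl ?lerDr.
Qed.

Lemma cr_diff_continuous (f g : R -> R) (t : R) :
  cr_diff (f t) (g t) -> {for t, continuous f} -> {for t, continuous g} ->
  {for t, continuous (fun s => u (f s) (g s))} /\
  {for t, continuous (fun s => v (f s) (g s))}.
Proof.
move=> /cr_diff_near h cf cg.
by split; apply/(@cvgrPdist_le _ R^o) => e e0; have [r r0 hr] := h e e0;
  have /(@cvgrPdist_le _ R^o)/(_ _ r0) cf' := cf;
  have /(@cvgrPdist_le _ R^o)/(_ _ r0) cg' := cg;
  near=> s; rewrite distrC; apply hr; rewrite distrC; near: s.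
Unshelve. all: by end_near. Qed.

(** In polar coordinates one Cauchy-Riemann equation reads [r du/dr = dv/dt], so the field
    [(u, - v / r)] is divergence free in the [(r, t)] plane. *)
Definition polarU (r t : R) := u (r * cos t) (r * sin t).
Definition polarV (r t : R) := - (v (r * cos t) (r * sin t) / r).

Lemma trig_expansion (t0 e : R) : 0 < e -> exists2 d, 0 < d & forall t,
  `|t - t0| <= d ->
    `|cos t - cos t0 + sin t0 * (t - t0)| <= e * `|t - t0| /\
    `|sin t - sin t0 - cos t0 * (t - t0)| <= e * `|t - t0|.
Proof.
move=> e0.
have exp (f : R -> R) (df : R) : is_derive t0 1 f df -> exists2 d, 0 < d &
    forall t, `|t - t0| <= d -> `|f t - f t0 - df * (t - t0)| <= e * `|t - t0|.
  by move=> [/derivable_expansion h <-]; exact: h.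
have [d1 d10 h1] := exp _ _ (is_derive_cos t0).
have [d2 d20 h2] := exp _ _ (is_derive_sin t0).
exists (Num.min d1 d2); first by rewrite lt_min d10.
move=> t; rewrite le_min => /andP[k1 k2]; split; last exact: h2.
by have := h1 t k1; rewrite mulNr opprK.
Qed.

Lemma polar_divergence_free (r0 t0 : R) : 0 < r0 ->
  cr_diff (r0 * cos t0) (r0 * sin t0) -> divergence_free polarU polarV r0 t0.
Proof.
move=> r00 [p [q hpq]]; exists (p * cos t0 - q * sin t0) => e e0.
(* [K] is a Lipschitz constant of the polar map at [(r0, t0)], and [2 / r0] bounds [1 / r] nearby;
   [e1] absorbs both. [e2] and [e3] absorb the size [N] of the derivative. *)
pose N := `|p| + `|q|; have N0 : 0 <= N by rewrite addr_ge0.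
have N10 : 0 < N + 1 by rewrite ltr_wpDl.
pose K := 2 + 4 * r0; have K0 : 0 < K by rewrite /K; lra.
have irK : 0 < 1 + 2 / r0 by rewrite ltr_pwDl// ltW// divr_gt0.
pose e1 := e / (4 * K) / (1 + 2 / r0).
have e10 : 0 < e1 by rewrite !divr_gt0// mulr_gt0.
have e1K : e1 * K <= e / 4.
  have -> : e1 * K = e / 4 / (1 + 2 / r0).
    by rewrite /e1; field; rewrite !gt_eqF//; lra.
  rewrite ler_pdivrMr// ler_peMr//; first by rewrite divr_ge0// ltW.
  by rewrite lerDl ltW// divr_gt0.
have e1Kr : e1 * K * (2 / r0) <= e / 4.
  have -> : e1 * K * (2 / r0) = e / 4 * ((2 / r0) / (1 + 2 / r0)).
    by rewrite /e1; field; rewrite !gt_eqF//; lra.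
  rewrite ler_piMr//; first by rewrite divr_ge0// ltW.
  by rewrite ler_pdivrMr// mul1r lerDr.
have [d1 d10 h1] := hpq e1 e10.
pose e2 := Num.min 1 (e / 4 / (N + 1)).
have e20 : 0 < e2 by rewrite lt_min ltr01 !divr_gt0.
have Ne2 : N * e2 <= e / 4.
  apply: (@le_trans _ _ (N * (e / 4 / (N + 1)))).
    by rewrite ler_wpM2l// ge_min lexx orbT.
  rewrite mulrA ler_pdivrMr// mulrC ler_wpM2l//; first by rewrite divr_ge0// ltW.
  by rewrite lerDl.
have [d2 d20 h2] := trig_expansion t0 e20.
pose e3 := e / 4 / (N + 1) / 2.
have e30 : 0 < e3 by rewrite !divr_gt0.
have Ne3 : N * (2 * e3) <= e / 4.
  have -> : N * (2 * e3) = (e / 4) * N / (N + 1).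
    by rewrite /e3; field; rewrite gt_eqF.
  by rewrite ler_pdivrMr// ler_wpM2l//; [rewrite divr_ge0// ltW|rewrite lerDl].
pose d := Num.min (Num.min d2 e3) (Num.min (r0 / 2) (d1 / (2 * K))).
have d0 : 0 < d by rewrite !lt_min d20 e30 !divr_gt0// mulr_gt0.
have lip t : `|t - t0| <= d ->
    `|cos t - cos t0| <= 2 * `|t - t0| /\ `|sin t - sin t0| <= 2 * `|t - t0|.
  rewrite !le_min => /andP[/andP[td _] _]; have [k1 k2] := h2 t td.
  have e21 : e2 * `|t - t0| <= `|t - t0|.
    by rewrite ler_piMl// ge_min lexx.
  have c1 : `|sin t0 * (t - t0)| <= `|t - t0|.
    by rewrite normrM ler_piMl// ler_norml sin_geN1 sin_le1.
  have c2 : `|cos t0 * (t - t0)| <= `|t - t0|.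
    by rewrite normrM ler_piMl// ler_norml cos_geN1 cos_le1.
  split.
    rewrite -(addrK (sin t0 * (t - t0)) (cos t - cos t0)).
    apply: le_trans (ler_normB _ _) _; apply: le_trans (lerD k1 c1) _; clear -e21; lra.
  rewrite -(subrK (cos t0 * (t - t0)) (sin t - sin t0)).
  apply: le_trans (ler_normD _ _) _; apply: le_trans (lerD k2 c2) _; clear -e21; lra.
have dist (c : R -> R) r t : (forall s, `|c s| <= 1) ->
    `|c t - c t0| <= 2 * `|t - t0| ->
    `|r * c t - r0 * c t0| <= `|r - r0| + 2 * r0 * `|t - t0|.
  move=> c1 ct.
  have -> : r * c t - r0 * c t0 = (r - r0) * c t + r0 * (c t - c t0) by ring.
  apply: le_trans (ler_normD _ _) _; apply: lerD.
    by rewrite normrM ler_piMr.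
  by rewrite normrM (gtr0_norm r00) mulrC (mulrC 2) -mulrA mulrC ler_wpM2l// ltW.
have cos1 s : `|cos s : R| <= 1 by rewrite ler_norml cos_geN1 cos_le1.
have sin1 s : `|sin s : R| <= 1 by rewrite ler_norml sin_geN1 sin_le1.
pose A r t := `|r * cos t - r0 * cos t0| + `|r * sin t - r0 * sin t0|.
have AK r t : `|t - t0| <= d -> A r t <= K * (`|r - r0| + `|t - t0|).
  move=> /lip[l1 l2]; apply: le_trans (lerD (dist _ r t cos1 l1)
    (dist _ r t sin1 l2)) _.
  have a0 := normr_ge0 (r - r0); have b0 := normr_ge0 (t - t0).
  have p0 : 0 <= r0 * `|r - r0| by rewrite mulr_ge0// ltW.
  rewrite /K; clear -a0 b0 p0; lra.
have local r t : `|r - r0| <= d -> `|t - t0| <= d ->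
    `|u (r * cos t) (r * sin t) - u (r0 * cos t0) (r0 * sin t0)
      - (p * (r * cos t - r0 * cos t0) - q * (r * sin t - r0 * sin t0))|
      <= e1 * K * (`|r - r0| + `|t - t0|) /\
    `|v (r * cos t) (r * sin t) - v (r0 * cos t0) (r0 * sin t0)
      - (q * (r * cos t - r0 * cos t0) + p * (r * sin t - r0 * sin t0))|
      <= e1 * K * (`|r - r0| + `|t - t0|).
  move=> rd td; have h := AK r t td.
  have hd : A r t <= d1.
    apply: le_trans h _; rewrite mulrC -ler_pdivlMr//.
    apply: le_trans (lerD rd td) _.
    have : d <= d1 / (2 * K) by rewrite !ge_min lexx !orbT.
    have -> : d1 / (2 * K) = d1 / K / 2 by field; rewrite gt_eqF.
    clear; lra.
  have [||k1 k2] := h1 (r * cos t) (r * sin t).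
  - by apply: le_trans hd; rewrite lerDl.
  - by apply: le_trans hd; rewrite lerDr.
  by rewrite -mulrA; split; [apply: le_trans k1 _|apply: le_trans k2 _];
    rewrite ler_wpM2l// ltW.
exists d => // r r' t t' rd rd' td td'; split.
  have [k1 _] := local r t rd td; have [k2 _] := local r' t rd' td.
  have [l1 l2] := lip t td.
  set a := `|r - r0| in k1 *; set a' := `|r' - r0| in k2 *.
  set b := `|t - t0| in k1 k2 l1 l2 td *.
  rewrite /polarU; set u0 := u (r0 * _) _ in k1 k2.
  set ur := u (r * _) _ in k1 *; set ur' := u (r' * _) _ in k2 *.
  (* Both values are expanded at the base point; the last summand accounts for the turn of the
     radial direction from [t0] to [t]. *)
  have -> : ur' - ur - (p * cos t0 - q * sin t0) * (r' - r) =
     (ur' - u0 - (p * (r' * cos t - r0 * cos t0) - q * (r' * sin t - r0 * sin t0)))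
   - (ur - u0 - (p * (r * cos t - r0 * cos t0) - q * (r * sin t - r0 * sin t0)))
   + (p * (cos t - cos t0) - q * (sin t - sin t0)) * (r' - r) by ring.
  have k3 : `|(p * (cos t - cos t0) - q * (sin t - sin t0)) * (r' - r)|
      <= e / 4 * (a' + a).
    rewrite normrM; apply: ler_pM => //; last first.
      have -> : r' - r = (r' - r0) - (r - r0) by ring.
      exact: ler_normB.
    apply: le_trans (ler_normB _ _) _; rewrite !normrM; apply: le_trans _ Ne3.
    rewrite /N mulrDl; have b3 : b <= e3.
      by apply: le_trans td _; rewrite !ge_min lexx !orbT.
    by apply: lerD; apply: ler_wpM2l => //; [apply: le_trans l1 _|apply: le_trans l2 _];
      rewrite ler_wpM2l.
  apply: le_trans (ler_normD _ _) _.
  apply: le_trans (lerD (ler_normB _ _) (lexx _)) _.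
  apply: le_trans (lerD (lerD k2 k1) k3) _.
  have a0 : 0 <= a by exact: normr_ge0. have a'0 : 0 <= a' by exact: normr_ge0. have b0 : 0 <= b by exact: normr_ge0.
  have m1 : e1 * K * (a' + b) <= e / 4 * (a' + b) by rewrite ler_wpM2r// addr_ge0.
  have m2 : e1 * K * (a + b) <= e / 4 * (a + b) by rewrite ler_wpM2r// addr_ge0.
  have p1 : 0 <= e * a by rewrite mulr_ge0// ltW.
  have p2 : 0 <= e * a' by rewrite mulr_ge0// ltW.
  have p3 : 0 <= e * b by rewrite mulr_ge0// ltW.
  clear -m1 m2 p1 p2 p3; lra.
have [_ k1] := local r t rd td; have [_ k2] := local r t' rd td'.
have [g1 g2] : `|t - t0| <= d2 /\ `|t' - t0| <= d2.
  by split; [apply: le_trans td _|apply: le_trans td' _]; rewrite !ge_min lexx.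
have [l1 l2] := h2 t g1; have [l1' l2'] := h2 t' g2.
have rr : r0 / 2 <= r.
  have : `|r - r0| <= r0 / 2 by apply: le_trans rd _; rewrite !ge_min lexx !orbT.
  by rewrite ler_norml => /andP[h _]; clear -h; lra.
have r_gt0 : 0 < r by apply: lt_le_trans rr; rewrite divr_gt0.
set a := `|r - r0| in k1 k2 *; set b := `|t - t0| in k1 l1 l2 *.
set b' := `|t' - t0| in k2 l1' l2' *.
rewrite /polarV; set v0 := v (r0 * _) _ in k1 k2.
set vt := v _ _ in k1 *; set vt' := v _ _ in k2 *.
set E := vt - _ - _ in k1; set E' := vt' - _ - _ in k2.
have rN0 : r != 0 by rewrite gt_eqF.
(* Both points have the same radius [r], which cancels in the linear part; there only the expansion
   errors of [cos] and [sin] remain. *)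
have -> : - (vt' / r) - - (vt / r) + (p * cos t0 - q * sin t0) * (t' - t) =
   (E - E') / r
   - q * ((cos t' - cos t0 + sin t0 * (t' - t0))
          - (cos t - cos t0 + sin t0 * (t - t0)))
   - p * ((sin t' - sin t0 - cos t0 * (t' - t0))
          - (sin t - sin t0 - cos t0 * (t - t0))).
  by rewrite /E /E'; field.
have a0 : 0 <= a by exact: normr_ge0. have b0 : 0 <= b by exact: normr_ge0. have b'0 : 0 <= b' by exact: normr_ge0.
have s1 : `|(E - E') / r| <= e / 4 * (a + b + (a + b')).
  rewrite normrM normfV (gtr0_norm r_gt0) ler_pdivrMr//.
  apply: le_trans (ler_normB _ _) _; apply: le_trans (lerD k1 k2) _.
  rewrite -mulrDr [leRHS]mulrAC ler_wpM2r ?addr_ge0//.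
  apply: (@le_trans _ _ (e / 4 * (r0 / 2))); last first.
    by rewrite ler_wpM2l// divr_ge0// ltW.
  rewrite -ler_pdivrMr ?divr_gt0// invf_div; exact: e1Kr.
have s2 : `|q * ((cos t' - cos t0 + sin t0 * (t' - t0))
          - (cos t - cos t0 + sin t0 * (t - t0)))| <= `|q| * e2 * (b' + b).
  rewrite normrM -mulrA ler_wpM2l// [leRHS]mulrDr.
  by apply: le_trans (ler_normB _ _) _; apply: lerD.
have s3 : `|p * ((sin t' - sin t0 - cos t0 * (t' - t0))
          - (sin t - sin t0 - cos t0 * (t - t0)))| <= `|p| * e2 * (b' + b).
  rewrite normrM -mulrA ler_wpM2l// [leRHS]mulrDr.
  by apply: le_trans (ler_normB _ _) _; apply: lerD.
apply: le_trans (ler_normB _ _) _.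
apply: le_trans (lerD (ler_normB _ _) (lexx _)) _.
apply: le_trans (lerD (lerD s1 s2) s3) _.
have m : N * e2 * (b' + b) <= e / 4 * (b' + b) by rewrite ler_wpM2r// addr_ge0.
have p1 : 0 <= e * a by rewrite mulr_ge0// ltW.
have p2 : 0 <= e * b by rewrite mulr_ge0// ltW.
have p3 : 0 <= e * b' by rewrite mulr_ge0// ltW.
have m' : `|q| * e2 * (b' + b) + `|p| * e2 * (b' + b) = N * e2 * (b' + b).
  by rewrite /N; ring.
clear -m m' p1 p2 p3; lra.
Qed.

(** Zero flux over [[r1, rho] x [0, 2 pi]] says that [u] has the same average over both circles,
    because the sides [t = 0] and [t = 2 pi] cancel. The inner radius [r1] stays positive, as the
    polar field degenerates at the origin, but is so small that [u] is at least [u 0 0 - e] on the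
    inner circle. *)
Lemma mean_value_le (rho M : R) : 0 < rho ->
  (forall x y, x ^+ 2 + y ^+ 2 <= rho ^+ 2 -> cr_diff x y) ->
  (forall x y, x ^+ 2 + y ^+ 2 = rho ^+ 2 -> u x y <= M) -> u 0 0 <= M.
Proof.
move=> rho0 h hM.
have sq (r t : R) : (r * cos t) ^+ 2 + (r * sin t) ^+ 2 = r ^+ 2.
  by rewrite !exprMn -mulrDr cos2Dsin2 mulr1.
have hp r t : 0 < r <= rho -> cr_diff (r * cos t) (r * sin t).
  by move=> /andP[r0 rr]; apply: h; rewrite sq ler_sqr// nnegrE ltW.
apply/ler_addgt0Pr => e e0.
have c0 : cr_diff 0 0 by apply: h; rewrite expr0n/= addr0 sqr_ge0.
have [r r0 hr] := cr_diff_near c0 e0.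
pose r1 := Num.min r rho.
have r10 : 0 < r1 by rewrite lt_min r0.
have r1rho : r1 <= rho by rewrite ge_min lexx orbT.
have pi0 : 0 <= 2 * pi :> R by rewrite mulr_ge0// pi_ge0.
have cU x : 0 < x <= rho -> cont_seg (polarU x) 0 (2 * pi).
  move=> hx t _; have [] // := @cr_diff_continuous
    (fun t => x * cos t) (fun t => x * sin t) t (hp _ _ hx).
    apply: continuousM; [exact: cst_continuous|exact: continuous_cos].
  apply: continuousM; [exact: cst_continuous|exact: continuous_sin].
have cl : cont_lines polarU polarV r1 rho 0 (2 * pi).
  split=> [x /andP[x1 x2]|t _ x /andP[x1 x2]].
    by apply: cU; rewrite x2 (lt_le_trans r10).
  have x0 : 0 < x := lt_le_trans r10 x1.
  apply: continuousN; apply: continuousM; last first.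
    by apply: continuousV; rewrite ?gt_eqF//; exact: cvg_id.
  have [] // := @cr_diff_continuous (fun x => x * cos t) (fun x => x * sin t) x.
  - by apply: hp; rewrite x0.
  - by apply: continuousM; [exact: cvg_id|exact: cst_continuous].
  - by apply: continuousM; [exact: cvg_id|exact: cst_continuous].
have := flux_eq0 r1rho pi0 cl.
have df x t : r1 <= x <= rho -> 0 <= t <= 2 * pi ->
    divergence_free polarU polarV x t.
  move=> /andP[x1 x2] _; have x0 : 0 < x := lt_le_trans r10 x1.
  by apply: polar_divergence_free => //; apply: hp; rewrite x0.
move=> /(_ df); rewrite /flux.
have -> : seg_int (fun x => polarV x (2 * pi) - polarV x 0) r1 rho = 0.
  rewrite (_ : seg_int _ _ _ = seg_int (fun=> 0) r1 rho).
    by rewrite seg_int_cst// mul0r.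
  apply: eq_seg_int => x _; rewrite /polarV.
  by rewrite mulr_natl cos2pi sin2pi cos0 sin0 subrr.
rewrite addr0 => hI.
have hle : seg_int (fun y => polarU rho y - polarU r1 y) 0 (2 * pi)
    <= (M - (u 0 0 - e)) * (2 * pi - 0).
  rewrite -seg_int_cst//; apply: seg_int_le.
  - by apply: cont_segB; apply: cU; rewrite ?r10 ?rho0/=.
  - exact: cont_seg_cst.
  move=> t _; apply: lerB; first by apply: hM; exact: sq.
  have small c : `|c| <= 1 -> `|r1 * c - 0| <= r.
    move=> c1; rewrite subr0 normrM (gtr0_norm r10).
    by apply: (@le_trans _ _ r1); [rewrite ler_piMr// ltW|rewrite ge_min lexx].
  have [||+ _] := hr (r1 * cos t) (r1 * sin t).
  - by apply: small; rewrite ler_norml cos_geN1 cos_le1.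
  - by apply: small; rewrite ler_norml sin_geN1 sin_le1.
  by rewrite ler_norml => /andP[+ _]; rewrite /polarU; lra.
move: hle; rewrite hI subr0 pmulr_lge0; last by rewrite mulr_gt0// pi_gt0.
by rewrite subr_ge0; lra.
Qed.

End Polar.

(** * Complex differentiability in real coordinates *)

Section ComplexNorm.
Variable R : realType.
Implicit Types z w : R[i].

Lemma normE z : `|z| = (normc z)%:C%C. Proof. by []. Qed.

Lemma normc_ge0 z : 0 <= normc z.
Proof. by case: z => x y; exact: sqrtr_ge0. Qed.

Lemma normc_sqr z : normc z ^+ 2 = Re z ^+ 2 + Im z ^+ 2.
Proof. by case: z => x y /=; rewrite sqr_sqrtr// addr_ge0// sqr_ge0. Qed.

Lemma le_normcE z (r : R) : 0 <= r -> (normc z <= r) = (Re z ^+ 2 + Im z ^+ 2 <= r ^+ 2).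
Proof. by move=> r0; rewrite -normc_sqr ler_sqr// nnegrE// normc_ge0. Qed.

Lemma Re_le_normc z : `|Re z| <= normc z.
Proof.
rewrite -ler_sqr ?nnegrE ?normc_ge0// normc_sqr real_normK ?num_real//.
by rewrite lerDl sqr_ge0.
Qed.

Lemma Im_le_normc z : `|Im z| <= normc z.
Proof.
rewrite -ler_sqr ?nnegrE ?normc_ge0// normc_sqr real_normK ?num_real//.
by rewrite lerDr sqr_ge0.
Qed.

Lemma normc_le_ReIm z : normc z <= `|Re z| + `|Im z|.
Proof.
have p : 0 <= `|Re z| * `|Im z| by rewrite mulr_ge0.
rewrite le_normcE ?addr_ge0// sqrrD !real_normK ?num_real//.
rewrite -addrA lerD2l [leRHS]addrC lerDl.
by rewrite mulrn_wge0.
Qed.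

Lemma ltc0_real z : 0 < z -> z = (Re z)%:C%C /\ 0 < Re z.
Proof. by case: z => a b; rewrite ltcE/= => /andP[/eqP-> ->]. Qed.

Lemma derivable_cr_diff (h : CC R -> CC R) (x0 y0 : R) :
  derivable h (x0 +i* y0)%C 1 ->
  cr_diff (fun x y => Re (h (x +i* y)%C)) (fun x y => Im (h (x +i* y)%C)) x0 y0.
Proof.
move=> /derivable_expansion hd.
set D := 'D_1 h _ in hd.
exists (Re D), (Im D) => e e0.
have [|r /ltc0_real[-> r0] hr] := hd e%:C%C; first by rewrite ltcR.
exists (Re r / 2) => [|x y xr yr]; first by rewrite divr_gt0.
have n1 : normc (x +i* y - x0 +i* y0)%C <= `|x - x0| + `|y - y0|.
  exact: normc_le_ReIm.
have := hr (x +i* y)%C; rewrite !normE -rmorphM !lecR.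
move=> /(_ ltac:(lra)) k.
have k' : normc (h (x +i* y)%C - h (x0 +i* y0)%C - D * (x +i* y - x0 +i* y0)%C)
    <= e * (`|x - x0| + `|y - y0|).
  by apply: le_trans k _; rewrite ler_wpM2l// ltW.
have k1 := le_trans (Re_le_normc _) k'; have k2 := le_trans (Im_le_normc _) k'.
move: k1 k2; case: (h (x +i* y)%C) (h (x0 +i* y0)%C) D {hd hr k k'} =>
  [a b] [a' b'] [p q] /= k1 k2; split.
  exact: le_trans k1.
apply: le_trans k2; rewrite le_eqVlt; apply/orP; left; apply/eqP.
by congr (`|_|); ring.
Qed.

Lemma Re_mean_value_le (h : CC R -> CC R) (rho M : R) : 0 < rho ->
  (forall z, normc z <= rho -> derivable h z 1) ->
  (forall z, normc z = rho -> Re (h z) <= M) -> Re (h 0) <= M.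
Proof.
move=> rho0 hd hM.
apply: (@mean_value_le R (fun x y => Re (h (x +i* y)%C))
  (fun x y => Im (h (x +i* y)%C)) rho M) => // x y hxy.
  by apply: derivable_cr_diff; apply: hd; rewrite le_normcE// ltW.
apply: hM; apply/eqP; rewrite -(@eqrXn2 _ 2)// ?normc_ge0 ?ltW//.
by rewrite normc_sqr/= hxy.
Qed.

End ComplexNorm.

(** * Contractive matrices *)

Section SquaredModulus.
Variable R : realType.
Implicit Types x y z w : R[i].

Lemma conjD x y : (x + y)^* = x^* + y^*. Proof. exact: rmorphD. Qed.
Lemma conjB x y : (x - y)^* = x^* - y^*. Proof. exact: rmorphB. Qed.
Lemma conjN x : (- x)^* = - x^*. Proof. exact: rmorphN. Qed.
Lemma conjM x y : (x * y)^* = x^* * y^*. Proof. exact: rmorphM. Qed.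
Lemma conj1 : (1 : R[i])^* = 1. Proof. exact: rmorph1. Qed.
Lemma conj0 : (0 : R[i])^* = 0. Proof. exact: rmorph0. Qed.
Definition conjE := (conjD, conjB, conjN, conjM, conj1, conj0, @conjCK R[i]).

Definition sqn z : R := normc z ^+ 2.

Lemma sqnRI z : sqn z = Re z ^+ 2 + Im z ^+ 2. Proof. exact: normc_sqr. Qed.

Lemma sqn_ge0 z : 0 <= sqn z. Proof. exact: sqr_ge0. Qed.

Lemma sqnE z : (sqn z)%:C%C = z * z^*.
Proof. by case: z => a b; rewrite sqnRI; apply/eqP; rewrite eq_complex/=; apply/andP; split; apply/eqP; ring. Qed.

Lemma sqn_conj z : sqn z^* = sqn z.
Proof. by case: z => a b; rewrite !sqnRI/=; ring. Qed.

Lemma sqnN z : sqn (- z) = sqn z. Proof. by rewrite /sqn normcN. Qed.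

Lemma sqnM z w : sqn (z * w) = sqn z * sqn w.
Proof. by rewrite /sqn normcM exprMn. Qed.

Lemma sqn0 : sqn 0 = 0. Proof. by rewrite sqnRI/= expr0n/= addr0. Qed.

Lemma sqn1 : sqn 1 = 1. Proof. by rewrite sqnRI/= expr0n/= addr0 expr1n. Qed.

Lemma sqn_eq0 z : (sqn z == 0) = (z == 0).
Proof.
rewrite sqnRI paddr_eq0 ?sqr_ge0// !sqrf_eq0.
by case: z => a b; rewrite eq_complex.
Qed.

Lemma addJ z : z + z^* = (2 * Re z)%:C%C.
Proof. by case: z => a b; apply/eqP; rewrite eq_complex/=; apply/andP; split; apply/eqP; ring. Qed.

Lemma ReD z w : Re (z + w) = Re z + Re w. Proof. by case: z w => ? ? []. Qed.

Definition n2 z w : R := sqn z + sqn w.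

Lemma n2_ge0 z w : 0 <= n2 z w. Proof. by rewrite addr_ge0// sqn_ge0. Qed.

Lemma n2E z w : (n2 z w)%:C%C = z * z^* + w * w^*.
Proof. by rewrite rmorphD/= !sqnE. Qed.

(* Lagrange's identity. *)
Lemma sqn_dot_le x y z w : sqn (x * z^* + y * w^*) <= n2 x y * n2 z w.
Proof.
rewrite -subr_ge0.
suff -> : n2 x y * n2 z w - sqn (x * z^* + y * w^*) = sqn (x * w - y * z).
  exact: sqn_ge0.
apply: complexI; rewrite rmorphB rmorphM !rmorphD/= !sqnE !conjE; ring.
Qed.

End SquaredModulus.

Section Contractions.
Variable R : realType.
Implicit Types a b c d u v z w : R[i].

Definition contraction a b c d := forall u v,
  n2 (a * u + b * v) (c * u + d * v) <= n2 u v.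

(** Put [w = A^* x]. Then [|w|^2] is the inner product of [A w] and [x], so Cauchy-Schwarz gives
    [|w|^4 <= |A w|^2 |x|^2 <= |w|^2 |x|^2], and [|w|^2] is divided out. *)
Lemma contraction_adjoint a b c d : contraction a b c d ->
  contraction a^* c^* b^* d^*.
Proof.
move=> h u v; set w1 := a^* * u + _; set w2 := b^* * u + _.
have [->|W0] := eqVneq (n2 w1 w2) 0; first exact: n2_ge0.
have Wp : 0 < n2 w1 w2 by rewrite lt_neqAle eq_sym W0 n2_ge0.
rewrite -(ler_pM2l Wp).
apply: (@le_trans _ _ (n2 (a * w1 + b * w2) (c * w1 + d * w2) * n2 u v)).
  apply: le_trans (sqn_dot_le _ _ _ _).
  have -> : (a * w1 + b * w2) * u^* + (c * w1 + d * w2) * v^* =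
      (n2 w1 w2)%:C%C.
    by rewrite rmorphD/= !sqnE /w1 /w2 !conjE; ring.
  by rewrite sqnRI/= expr0n/= addr0.
by rewrite ler_wpM2r ?n2_ge0.
Qed.

(** For [D = 1 - A^* A] this is [D^2 <= D]: expanding [|D x|^2] gives
    [|x|^2 - 2 |A x|^2 + |A^* A x|^2], and the last term is at most [|A x|^2]. *)
Lemma defect_le a b c d u v : contraction a b c d ->
  let w1 := a * u + b * v in let w2 := c * u + d * v in
  n2 (u - (a^* * w1 + c^* * w2)) (v - (b^* * w1 + d^* * w2))
    <= n2 u v - n2 w1 w2.
Proof.
move=> h; cbv zeta; set w1 := a * u + _; set w2 := c * u + _.
have k := contraction_adjoint h w1 w2.
suff -> : n2 (u - (a^* * w1 + c^* * w2)) (v - (b^* * w1 + d^* * w2)) =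
   n2 u v - n2 w1 w2 - n2 w1 w2 + n2 (a^* * w1 + c^* * w2) (b^* * w1 + d^* * w2).
  lra.
apply: complexI; rewrite !(rmorphB, rmorphD)/= !sqnE /w1 /w2 !conjE; ring.
Qed.

(** Adding [z] times the rank one matrix [p l] changes [|A x|^2] by
    [2 Re (z s q) + |z|^2 |s|^2 |p|^2]. Both [|s|^2] and [|q|^2] are at most the defect [e], so for
    [|z| <= 1/3] the change is at most [(2/3 + 1/9) e]. *)
Lemma rank1_contraction a b c d p1 p2 l1 l2 z :
  n2 p1 p2 <= 1 ->
  (forall u v (w1 := a * u + b * v) (w2 := c * u + d * v)
     (e := n2 u v - n2 w1 w2),
     sqn (l1 * u + l2 * v) <= e /\ sqn (p1 * w1^* + p2 * w2^*) <= e) ->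
  normc z <= 3^-1 ->
  contraction (a + z * (p1 * l1)) (b + z * (p1 * l2))
              (c + z * (p2 * l1)) (d + z * (p2 * l2)).
Proof.
move=> p12 h z3 u v; have [] := h u v.
set w1 := a * u + _; set w2 := c * u + _.
set s := l1 * u + _; set q := p1 * _ + _; set e := _ - _ => hs hq.
have -> : n2 ((a + z * (p1 * l1)) * u + (b + z * (p1 * l2)) * v)
   ((c + z * (p2 * l1)) * u + (d + z * (p2 * l2)) * v)
   = n2 w1 w2 + 2 * Re (z * (s * q)) + sqn z * sqn s * n2 p1 p2.
  apply: complexI; transitivity ((n2 w1 w2)%:C%C +
      (z * (s * q) + (z * (s * q))^*) + (sqn z)%:C%C * (sqn s)%:C%C
        * (n2 p1 p2)%:C%C); last by rewrite addJ -!(rmorphD, rmorphM).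
  rewrite !n2E !sqnE /w1 /w2 /s /q !conjE; ring.
have e0 : 0 <= e by apply: le_trans hs; exact: sqn_ge0.
have sq : normc (s * q) <= e.
  rewrite -ler_sqr ?nnegrE ?normc_ge0// normcM exprMn (expr2 e).
  by apply: ler_pM => //; exact: sqr_ge0.
have t1 : Re (z * (s * q)) <= 3^-1 * e.
  apply: le_trans (ler_norm _) _; apply: le_trans (Re_le_normc _) _.
  by rewrite normcM; apply: ler_pM => //; exact: normc_ge0.
have t2 : sqn z * sqn s * n2 p1 p2 <= 3^-1 * 3^-1 * e * 1.
  have z9 : sqn z <= 3^-1 * 3^-1.
    by rewrite /sqn expr2; apply: ler_pM => //; exact: normc_ge0.
  apply: ler_pM => //; [|exact: n2_ge0|].
    by apply: mulr_ge0; exact: sqn_ge0.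
  by apply: ler_pM => //; exact: sqn_ge0.
rewrite /e in e0 t1 t2 *; lra.
Qed.

Definition isometry_cols a b c d :=
  [/\ n2 a c = 1, n2 b d = 1 & a^* * b + c^* * d = 0].

Lemma contraction_perturbation a b c d : contraction a b c d ->
  isometry_cols a b c d \/ isometry_cols a^* c^* b^* d^* \/
  exists b1 b2 b3 b4, 0 < n2 b1 b2 + n2 b3 b4 /\ forall z, normc z <= 3^-1 ->
    contraction (a + z * b1) (b + z * b2) (c + z * b3) (d + z * b4).
Proof.
move=> h; have hadj := contraction_adjoint h.
(* the columns of [1 - A A^*] and the rows of [1 - A^* A]: the perturbation is
   [(1 - A A^* ) E_ij (1 - A^* A)] for a matrix unit [E_ij] *)
pose p11 := 1 - (a * a^* + b * b^*). pose p21 := - (c * a^* + d * b^*).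
pose p12 := - (a * c^* + b * d^*). pose p22 := 1 - (c * c^* + d * d^*).
pose l11 := 1 - (a^* * a + c^* * c). pose l12 := - (a^* * b + c^* * d).
pose l21 := - (b^* * a + d^* * c). pose l22 := 1 - (b^* * b + d^* * d).
have hl u v : n2 (l11 * u + l12 * v) (l21 * u + l22 * v) <=
    n2 u v - n2 (a * u + b * v) (c * u + d * v).
  have := defect_le u v h; cbv zeta.
  set x1 := u - _; set x2 := v - _.
  have -> : x1 = l11 * u + l12 * v by rewrite /x1 /l11 /l12; ring.
  by have -> : x2 = l21 * u + l22 * v by rewrite /x2 /l21 /l22; ring.
have hp u v : n2 (p11 * u + p12 * v) (p21 * u + p22 * v) <= n2 u v.
  have := defect_le u v hadj; cbv zeta; rewrite !conjCK.
  set x1 := u - _; set x2 := v - _.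
  have -> : x1 = p11 * u + p12 * v by rewrite /x1 /p11 /p12; ring.
  have -> : x2 = p21 * u + p22 * v by rewrite /x2 /p21 /p22; ring.
  by move=> k; apply: le_trans k _; rewrite gerBl n2_ge0.
have key p1 p2 l1 l2 : n2 p1 p2 <= 1 ->
    (forall u v, sqn (l1 * u + l2 * v) <=
       n2 (l11 * u + l12 * v) (l21 * u + l22 * v)) ->
    (forall u v, sqn (p1 * (a * u + b * v)^* + p2 * (c * u + d * v)^*) <=
      let y1 := l11 * u + l12 * v in let y2 := l21 * u + l22 * v in
      n2 (a * y1 + b * y2) (c * y1 + d * y2)) ->
    n2 p1 p2 != 0 -> n2 l1 l2 != 0 ->
    exists b1 b2 b3 b4, 0 < n2 b1 b2 + n2 b3 b4 /\ forall z, normc z <= 3^-1 ->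
    contraction (a + z * b1) (b + z * b2) (c + z * b3) (d + z * b4).
  move=> p1le hl1 hp1 pn0 ln0.
  exists (p1 * l1), (p1 * l2), (p2 * l1), (p2 * l2); split.
    have -> : n2 (p1 * l1) (p1 * l2) + n2 (p2 * l1) (p2 * l2) =
        n2 p1 p2 * n2 l1 l2 by rewrite /n2 !sqnM; ring.
    by rewrite lt_neqAle eq_sym mulf_neq0//= mulr_ge0// n2_ge0.
  move=> z; apply: rank1_contraction => // u v w1 w2 e; split.
    exact: le_trans (hl1 u v) (hl u v).
  apply: le_trans (hp1 u v) _; apply: le_trans _ (hl u v); exact: h.
have row1 u v : sqn (l11 * u + l12 * v) <=
    n2 (l11 * u + l12 * v) (l21 * u + l22 * v) by rewrite lerDl sqn_ge0.
have row2 u v : sqn (l21 * u + l22 * v) <=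
    n2 (l11 * u + l12 * v) (l21 * u + l22 * v) by rewrite lerDr sqn_ge0.
(* Since [(1 - A A^* ) A = A (1 - A^* A)], pairing a column of [1 - A A^*] with [A x] gives, up to
   conjugation, a coordinate of [A (1 - A^* A) x]. *)
have col1 u v : sqn (p11 * (a * u + b * v)^* + p21 * (c * u + d * v)^*) <=
    let y1 := l11 * u + l12 * v in let y2 := l21 * u + l22 * v in
    n2 (a * y1 + b * y2) (c * y1 + d * y2).
  cbv zeta; rewrite -[leLHS]sqn_conj.
  set x := (_ + _)^*; set y := a * _ + _.
  by have -> : x = y; [rewrite /x /y /p11 /p21 /l11 /l12 /l21 /l22 !conjE; ring|
    rewrite lerDl sqn_ge0].
have col2 u v : sqn (p12 * (a * u + b * v)^* + p22 * (c * u + d * v)^*) <=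
    let y1 := l11 * u + l12 * v in let y2 := l21 * u + l22 * v in
    n2 (a * y1 + b * y2) (c * y1 + d * y2).
  cbv zeta; rewrite -[leLHS]sqn_conj.
  set x := (_ + _)^*; set y := c * _ + _.
  by have -> : x = y; [rewrite /x /y /p12 /p22 /l11 /l12 /l21 /l22 !conjE; ring|
    rewrite lerDr sqn_ge0].
have np1 : n2 p11 p21 <= 1.
  have := hp 1 0; rewrite !mulr1 !mulr0 !addr0 => k; apply: le_trans k _.
  by rewrite /n2 sqn1 sqn0 addr0.
have np2 : n2 p12 p22 <= 1.
  have := hp 0 1; rewrite !mulr1 !mulr0 !add0r => k; apply: le_trans k _.
  by rewrite /n2 sqn1 sqn0 add0r.
have n2_0 x y : n2 x y = 0 -> x = 0 /\ y = 0.
  move/eqP; rewrite paddr_eq0 ?sqn_ge0// !sqn_eq0 => /andP[/eqP-> /eqP->].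
  by [].
have eqs x y : 1 - (x^* * x + y^* * y) = 0 -> n2 x y = 1.
  move=> k; apply: complexI; rewrite n2E rmorph1; apply/eqP.
  by rewrite eq_sym -subr_eq0 -k; apply/eqP; ring.
(* A nonzero row of [1 - A^* A] together with a nonzero column of [1 - A A^*] is a perturbation; if
   one of the two matrices vanishes, [A] or its adjoint has orthonormal columns. *)
have [/n2_0[a1 a2]|a0] := eqVneq (n2 l11 l12) 0.
  have [/n2_0[b1 b2]|b0] := eqVneq (n2 l21 l22) 0.
    left; split; [exact: eqs|exact: eqs|].
    by apply/eqP; rewrite -oppr_eq0; apply/eqP.
  right; have [/n2_0[c1 c2]|c0] := eqVneq (n2 p11 p21) 0; last first.
    by right; exact: (key p11 p21 l21 l22).
  have [/n2_0[d1 d2]|d0] := eqVneq (n2 p12 p22) 0; last first.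
    by right; exact: (key p12 p22 l21 l22).
  left; split; [apply: eqs; rewrite !conjCK; exact: c1|
    apply: eqs; rewrite !conjCK; exact: d2|].
  by rewrite !conjCK; apply/eqP; rewrite -oppr_eq0; apply/eqP.
right; have [/n2_0[c1 c2]|c0] := eqVneq (n2 p11 p21) 0; last first.
  by right; exact: (key p11 p21 l11 l12).
have [/n2_0[d1 d2]|d0] := eqVneq (n2 p12 p22) 0; last first.
  by right; exact: (key p12 p22 l11 l12).
left; split; [apply: eqs; rewrite !conjCK; exact: c1|
  apply: eqs; rewrite !conjCK; exact: d2|].
by rewrite !conjCK; apply/eqP; rewrite -oppr_eq0; apply/eqP.
Qed.

(** The adjoint is the inverse, that is, the adjugate divided by [p]; comparing entries expresses
    the second row by the first row and the determinant. *)
Lemma isometry_colsP a b c d : isometry_cols a b c d ->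
  let p := a * d - b * c in
  [/\ sqn p = 1, d = a^* * p, c = - (b^* * p) & n2 a b = 1].
Proof.
move=> [h1 h2 h3] p.
have h1' : a * a^* + c * c^* = 1 by rewrite -n2E h1.
have h2' : b * b^* + d * d^* = 1 by rewrite -n2E h2.
have h3' : a * b^* + c * d^* = 0.
  by rewrite -[RHS]conj0 -h3 !conjE; ring.
have hd : d = a^* * p.
  rewrite /p -[LHS]mulr1 -h1' -[LHS]addr0 -(mulr0 (- c)) -h3; ring.
have hc : c = - (b^* * p).
  rewrite /p -[LHS]mulr1 -h2' -[LHS]addr0 -(mulr0 (- d)) -h3'; ring.
have hp : sqn p = 1.
  apply: complexI; rewrite sqnE rmorph1.
  have -> : p * p^* = (a * a^* + c * c^*) * (b * b^* + d * d^*)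
     - (a^* * b + c^* * d) * (a * b^* + c * d^*) by rewrite /p !conjE; ring.
  by rewrite h1' h2' h3 mul0r subr0 mulr1.
split=> //; rewrite -h1 /n2 [in RHS]hc -mulNr sqnM hp mulr1.
by rewrite -[sqn (- _)]sqn_conj !conjE /sqn normcN.
Qed.

End Contractions.

Lemma differentiable_fst (K : numFieldType) (V W : normedModType K) (x : V * W) :
  differentiable (@fst V W) x.
Proof. by apply: linear_differentiable => y; exact: cvg_fst. Qed.

Lemma differentiable_snd (K : numFieldType) (V W : normedModType K) (x : V * W) :
  differentiable (@snd V W) x.
Proof. by apply: linear_differentiable => y; exact: cvg_snd. Qed.

(** * Continuity and compactness in the complex plane *)

Section ComplexTopology.
Variable R : realType.

Lemma normc_lip_continuous (f : CC R -> R) :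
  (forall z w, `|f z - f w| <= normc (z - w)) -> continuous f.
Proof.
move=> lf z; apply: (@cvgrPdist_le _ R^o (CC R) (nbhs (z : CC R)) _ f (f z)).2.
move=> e e0.
apply/nbhs_ballP; exists e%:C%C => /=; first by rewrite ltcR.
move=> w; rewrite -ball_normE/= normE ltcR => zw.
exact: le_trans (lf _ _) (ltW zw).
Qed.

Lemma continuous_Re : continuous (Re : CC R -> R).
Proof.
by apply: normc_lip_continuous => -[a b] [c d]; exact: (Re_le_normc (_ +i* _)%C).
Qed.

Lemma continuous_Im : continuous (Im : CC R -> R).
Proof.
by apply: normc_lip_continuous => -[a b] [c d]; exact: (Im_le_normc (_ +i* _)%C).
Qed.

Lemma continuous_normc : continuous (@normc R : CC R -> R).
Proof.
apply: normc_lip_continuous => z w; rewrite ler_norml; apply/andP; split.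
  rewrite lerNl opprB lerBlDr.
  have := le_normcD (w - z) z; rewrite subrK -opprB normcN; lra.
by rewrite lerBlDr; have := le_normcD (z - w) w; rewrite subrK; lra.
Qed.

Lemma continuous_sqn : continuous (@sqn R : CC R -> R).
Proof.
move=> z; rewrite /sqn; apply: (@continuous_comp _ _ _ (@normc R : CC R -> R) (fun x => x ^+ 2)).
  exact: continuous_normc.
exact: exprn_continuous.
Qed.

Lemma cvg_Complex (T : Type) (F : set_system T) (f g : T -> R) (a b : R) :
  Filter F -> f @ F --> a -> g @ F --> b ->
  (fun t => (f t +i* g t)%C : CC R) @ F --> (a +i* b : CC R)%C.
Proof.
move=> FF /(@cvgrPdist_le _ R^o) fa /(@cvgrPdist_le _ R^o) gb.
apply/(@cvgrPdist_le _ (CC R)) => e /ltc0_real[-> e0].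
have e20 : 0 < Re e / 2 by rewrite divr_gt0.
have {}fa := fa _ e20; have {}gb := gb _ e20.
near=> t; rewrite normE lecR; apply: le_trans (normc_le_ReIm _) _ => /=.
rewrite [leRHS]splitr; apply: lerD; [near: t|near: t] => //.
Unshelve. all: by end_near. Qed.

Lemma continuous_Complex (T : topologicalType) (f g : T -> R) :
  continuous f -> continuous g -> continuous (fun t => (f t +i* g t)%C : CC R).
Proof. by move=> cf cg t; apply: cvg_Complex; [exact: cf|exact: cg]. Qed.

Lemma continuous_conj : continuous (fun z : CC R => z^* : CC R).
Proof.
have -> : (fun z : CC R => z^* : CC R) = (fun z => (Re z +i* - Im z)%C).
  by apply/funext => -[].
apply: continuous_Complex; first exact: continuous_Re.
by move=> z; apply: continuousN; exact: continuous_Im.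
Qed.

Lemma compact_disc : compact [set z : CC R | normc z <= 1].
Proof.
have cq : compact (`[-1 : R, 1] `*` `[-1 : R, 1]).
  by apply: compact_setX; exact: segment_compact.
pose F := (fun x : R * R => (x.1 +i* x.2 : CC R)%C).
have cF : continuous F.
  by move=> x; apply: cvg_Complex; [exact: cvg_fst|exact: cvg_snd].
apply: (@subclosed_compact _ _ (F @` (`[-1 : R, 1] `*` `[-1 : R, 1]))).
- apply: (@preimage_closed _ _ (@normc R : CC R -> R) [set x | x <= 1]).
    by move=> z _; exact: continuous_normc.
  exact: closed_le.
- by apply: continuous_compact => //; exact: continuous_subspaceT.
move=> z /= z1; exists (Re z, Im z); last by case: z {z1}.
have := le_trans (Re_le_normc z) z1; have := le_trans (Im_le_normc z) z1.
by rewrite !ler_norml /= !in_itv/= => -> ->.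
Qed.

End ComplexTopology.

Lemma continuous_pair (X Y Z : topologicalType) (f : X -> Y) (g : X -> Z) x :
  {for x, continuous f} -> {for x, continuous g} ->
  {for x, continuous (fun x => (f x, g x))}.
Proof. by move=> cf cg; exact: (cvg_pair cf cg). Qed.

(** * The compact sets of contractions and of unitary matrices *)

Section ContractionSet.
Variable R : realType.
Implicit Types A B W : C4 R.

Lemma differentiable_c4 A :
  [/\ differentiable (fun A : C4 R => A`11) A,
      differentiable (fun A : C4 R => A`12) A,
      differentiable (fun A : C4 R => A`21) A &
      differentiable (fun A : C4 R => A`22) A].
Proof.
split.
- apply: (@differentiable_comp _ _ _ _ (fun A : C4 R => A.1.1) fst).
    apply: (@differentiable_comp _ _ _ _ (fun A : C4 R => A.1) fst);
    exact: differentiable_fst.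
  exact: differentiable_fst.
- apply: (@differentiable_comp _ _ _ _ (fun A : C4 R => A.1.1) snd).
    apply: (@differentiable_comp _ _ _ _ (fun A : C4 R => A.1) fst);
    exact: differentiable_fst.
  exact: differentiable_snd.
- apply: (@differentiable_comp _ _ _ _ (fun A : C4 R => A.1) snd).
    exact: differentiable_fst.
  exact: differentiable_snd.
- exact: differentiable_snd.
Qed.

Lemma differentiable_c3 (x : C3 R) :
  [/\ differentiable (fun x : C3 R => x.1.1 : CC R) x,
      differentiable (fun x : C3 R => x.1.2 : CC R) x &
      differentiable (fun x : C3 R => x.2 : CC R) x].
Proof.
split.
- apply: (@differentiable_comp _ _ _ _ (fun A : C3 R => A.1) fst);
    exact: differentiable_fst.
- apply: (@differentiable_comp _ _ _ _ (fun A : C3 R => A.1) snd).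
    exact: differentiable_fst.
  exact: differentiable_snd.
- exact: differentiable_snd.
Qed.

Definition contr4 : set (C4 R) :=
  [set A | contraction A`11 A`12 A`21 A`22].

(** The unitary matrices, given by first row and determinant. This form makes them a continuous
    image of a sphere times a circle, hence compact, and makes both domain maps explicit on them. *)
Definition unit4 : set (C4 R) := [set A | exists a b p,
  [/\ sqn p = 1, n2 a b = 1 & A = (a, b, - (b^* * p), a^* * p)]].

Definition scale (r : R) A : C4 R :=
  (r%:C%C * A`11, r%:C%C * A`12, r%:C%C * A`21, r%:C%C * A`22).

Lemma sqn_le1 (z : R[i]) : (sqn z <= 1) = (normc z <= 1).
Proof. by rewrite /sqn -[X in _ <= X](expr1n _ 2) ler_sqr// nnegrE// normc_ge0. Qed.

Lemma contraction_cols (a b c d : R[i]) : contraction a b c d ->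
  n2 a c <= 1 /\ n2 b d <= 1.
Proof.
move=> h; have := h 1 0; have := h 0 1.
by rewrite !mulr1 !mulr0 !addr0 !add0r /n2 sqn1 sqn0 addr0 add0r.
Qed.

Lemma contraction_rows (a b c d : R[i]) : contraction a b c d ->
  n2 a b <= 1 /\ n2 c d <= 1.
Proof.
move=> /contraction_adjoint/contraction_cols.
by rewrite /n2 !sqn_conj.
Qed.

Lemma contraction_unit (a b p : R[i]) : sqn p = 1 -> n2 a b = 1 ->
  contraction a b (- (b^* * p)) (a^* * p).
Proof.
move=> p1 ab u v; rewrite le_eqVlt; apply/orP; left; apply/eqP.
transitivity (n2 a b * n2 u v); last by rewrite ab mul1r.
have p1' : p * p^* = 1 by rewrite -sqnE p1.
apply: complexI; rewrite rmorphM/= !n2E !conjE.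
have -> : (- (b^* * p) * u + a^* * p * v) * (- (b * p^*) * u^* + a * p^* * v^*) =
  (- b^* * u + a^* * v) * (- b * u^* + a * v^*) * (p * p^*) by ring.
by rewrite p1' mulr1; ring.
Qed.

Lemma unit4_contr4 : unit4 `<=` contr4.
Proof. by move=> A [a [b [p [p1 ab ->]]]]; exact: contraction_unit. Qed.

Lemma contr4_scale r A : 0 <= r <= 1 -> contr4 A -> contr4 (scale r A).
Proof.
move=> /andP[r0 r1] h u v; apply: le_trans (h u v).
rewrite /scale/=.
have -> : forall x y : R[i], r%:C%C * x * u + r%:C%C * y * v = r%:C%C * (x * u + y * v).
  by move=> x y; ring.
have -> : forall x y : R[i], r%:C%C * x * u + r%:C%C * y * v = r%:C%C * (x * u + y * v).
  by move=> x y; ring.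
have rr : sqn r%:C%C = r ^+ 2 by rewrite sqnRI/= expr0n/= addr0.
rewrite /n2 !sqnM rr -mulrDr ler_piMl//; first by rewrite addr_ge0// sqn_ge0.
by rewrite expr_le1.
Qed.

Lemma closed_contr4 : closed contr4.
Proof.
pose f (uv : R[i] * R[i]) A := n2 (A`11 * uv.1 + A`12 * uv.2)
  (A`21 * uv.1 + A`22 * uv.2).
have -> : contr4 = \bigcap_(uv in [set: R[i] * R[i]])
    (f uv @^-1` [set x | x <= n2 uv.1 uv.2]).
  apply/seteqP; split=> [A h [u v] _|A h u v]; first exact: h.
  exact: (h (u, v)).
apply: closed_bigI => -[u v] _; apply: preimage_closed; last exact: closed_le.
move=> A _; rewrite /f /n2.
have [d1 d2 d3 d4] := differentiable_c4 A.
have lin (g h : C4 R -> CC R) : differentiable g A -> differentiable h A ->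
    {for A, continuous (fun A => sqn (g A * u + h A * v))}.
  move=> dg dh; apply: (@continuous_comp _ _ _ (fun A => g A * u + h A * v)
    (@sqn R : CC R -> R)); last exact: continuous_sqn.
  apply: differentiable_continuous.
  by apply: differentiableD; apply: differentiableM => //; exact: differentiable_cst.
by apply: (@continuousD _ R^o (C4 R)); exact: lin.
Qed.

Lemma compact_contr4 : compact contr4.
Proof.
pose D := [set z : CC R | normc z <= 1].
have cD : compact D by exact: compact_disc.
apply: (@subclosed_compact _ _ (D `*` D `*` D `*` D)); first exact: closed_contr4.
  by do !apply: compact_setX.
move=> [[[a b] c] d] /contraction_rows[] ab cd.
by rewrite /D /=; do !split=> /=; rewrite -sqn_le1;
  [apply: le_trans ab|apply: le_trans ab|apply: le_trans cd|apply: le_trans cd];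
  rewrite /n2 ?lerDl ?lerDr sqn_ge0.
Qed.

Lemma compact_sphere_circle :
  compact [set x : C3 R | n2 x.1.1 x.1.2 = 1 /\ sqn x.2 = 1].
Proof.
pose D := [set z : CC R | normc z <= 1].
have cD : compact D by exact: compact_disc.
apply: (@subclosed_compact _ _ (D `*` D `*` D)).
- have c3 := differentiable_c3; apply: closedI.
    apply: (@preimage_closed _ R^o (fun x : C3 R => n2 x.1.1 x.1.2) [set 1]).
      move=> x _; have [d1 d2 _] := c3 x; rewrite /n2.
      apply: (@continuousD _ R^o (C3 R)).
        apply: (@continuous_comp _ _ _ (fun x : C3 R => x.1.1 : CC R) (@sqn R : CC R -> R)).
          exact: differentiable_continuous.
        exact: continuous_sqn.
      apply: (@continuous_comp _ _ _ (fun x : C3 R => x.1.2 : CC R) (@sqn R : CC R -> R)).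
        exact: differentiable_continuous.
      exact: continuous_sqn.
    exact: closed_eq.
  apply: (@preimage_closed _ R^o (fun x : C3 R => sqn x.2) [set 1]).
    move=> x _; have [_ _ d3] := c3 x.
    apply: (@continuous_comp _ _ _ (fun x : C3 R => x.2 : CC R) (@sqn R : CC R -> R)).
      exact: differentiable_continuous.
    exact: continuous_sqn.
  exact: closed_eq.
- by do !apply: compact_setX.
move=> [[a b] c] /= [ab cd].
have a1 : sqn a <= 1 by rewrite -ab lerDl sqn_ge0.
have b1 : sqn b <= 1 by rewrite -ab lerDr sqn_ge0.
by split; [split|]; rewrite /D /= -sqn_le1 ?cd.
Qed.

Lemma compact_unit4 : compact unit4.
Proof.
pose f (x : C3 R) : C4 R :=
  (x.1.1, x.1.2, - ((x.1.2 : R[i])^* * x.2), (x.1.1 : R[i])^* * x.2).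
have -> : unit4 = f @` [set x : C3 R | n2 x.1.1 x.1.2 = 1 /\ sqn x.2 = 1].
  apply/seteqP; split=> [A [a [b [p [p1 ab ->]]]]|A [[[a b] p] [ab p1] <-]].
    by exists (a, b, p).
  by exists a, b, p.
apply: continuous_compact; last exact: compact_sphere_circle.
apply: continuous_subspaceT => x.
have [/differentiable_continuous d1 /differentiable_continuous d2
  /differentiable_continuous d3] := differentiable_c3 x.
have cj (g h : C3 R -> CC R) : {for x, continuous g} -> {for x, continuous h} ->
    {for x, continuous (fun x => (g x : R[i])^* * h x : CC R)}.
  move=> cg ch.
  have cc := @continuous_comp _ _ _ g _ x cg (@continuous_conj R (g x)).
  exact: (@continuousM _ _ _ _ _ cc ch).
have cn := @continuousN _ (CC R) _ _ _ (cj _ _ d2 d3).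
exact: (continuous_pair (continuous_pair (continuous_pair d1 d2) cn) (cj _ _ d1 d3)).
Qed.

End ContractionSet.

(** * Maximum principle on the matrix ball *)

Section MaximumPrinciple.
Variable R : realType.
Implicit Types A B W : C4 R.

Lemma unimodular_rotation (z : R[i]) :
  exists2 k : R[i], normc k = 1 & k * z = (normc z)%:C%C.
Proof.
have [->|z0] := eqVneq z 0.
  by exists 1; rewrite ?normc1// mulr0 normc0.
have nz : normc z != 0 by apply: contraNneq z0 => /eq0_normc->.
exists (z^* / (normc z)%:C%C).
  rewrite normcM normcV.
  have -> : normc z^* = normc z by case: z {z0 nz} => a b /=; rewrite sqrrN.
  have -> : normc (normc z)%:C%C = normc z.
    by rewrite /= expr0n/= addr0 sqrtr_sqr ger0_norm// normc_ge0.
  by rewrite divff.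
have nzC : (normc z)%:C%C != 0 :> R[i] by rewrite eq_complex/= eqxx andbT.
apply: (mulIf nzC); rewrite mulrAC divfK// mulrC -sqnE /sqn expr2.
by rewrite rmorphM.
Qed.

Lemma isometry_cols_unit4 A :
  isometry_cols A`11 A`12 A`21 A`22 \/
  isometry_cols (A`11 : R[i])^* (A`21 : R[i])^* (A`12 : R[i])^* (A`22 : R[i])^* ->
  unit4 A.
Proof.
case: A => -[[a b] c] d /= [h|h].
  have [p1 hd hc hab] := isometry_colsP h.
  by exists a, b, (a * d - b * c); rewrite -hc -hd.
have [p1 hd hc _] := isometry_colsP h; have [hab _ _] := h.
pose p := a * d - c * b.
have pp : a^* * d^* - c^* * b^* = p^* by rewrite /p !conjE.
rewrite pp sqn_conj in p1; rewrite pp conjCK in hd; rewrite pp conjCK in hc.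
exists a, b, p; split=> //; first by rewrite -hab /n2 !sqn_conj.
have pc : p^* * p = 1 by rewrite mulrC -sqnE p1.
congr (_, _, _, _).
  by rewrite hc mulNr opprK -mulrA pc mulr1.
by rewrite -[LHS]conjCK hd conjM conjCK.
Qed.

Definition frob A : R := n2 A`11 A`12 + n2 A`21 A`22.

Lemma frob_ge0 A : 0 <= frob A.
Proof. by rewrite addr_ge0// n2_ge0. Qed.

Lemma contr4_frob A : contr4 A -> frob A <= 2.
Proof. by move=> /contraction_rows[]; rewrite /frob; lra. Qed.

Definition line A B (z : CC R) : C4 R := (A`11 + z * B`11, A`12 + z * B`12,
  A`21 + z * B`21, A`22 + z * B`22).

Lemma frob_line A B z : frob (line A B z) = frob A + sqn z * frob B +
  2 * Re (z * (B`11 * (A`11 : R[i])^* + B`12 * (A`12 : R[i])^* +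
               B`21 * (A`21 : R[i])^* + B`22 * (A`22 : R[i])^*)).
Proof.
apply: complexI.
set t := z * _; transitivity ((frob A)%:C%C + (sqn z)%:C%C * (frob B)%:C%C + (t + t^*)).
  rewrite /frob ![(n2 _ _ + n2 _ _)%:C%C]rmorphD/= !n2E sqnE /t /line/= !conjE; ring.
by rewrite addJ -!(rmorphD, rmorphM).
Qed.

Lemma differentiable_scale_line r A B (z : CC R) :
  differentiable (fun z => scale r (line A B z)) z.
Proof.
have aff (a b : CC R) : differentiable (fun z : CC R => (r%:C%C : CC R) * (a + z * b)) z.
  apply: differentiableM; first exact: differentiable_cst.
  apply: differentiableD; first exact: differentiable_cst.
  apply: differentiableM; last exact: differentiable_cst.
  exact: ex_diff.
apply: differentiable_pair; last exact: aff.
apply: differentiable_pair; last exact: aff.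
by apply: differentiable_pair; exact: aff.
Qed.

Lemma line0 A B : line A B 0 = A.
Proof. by case: A => -[[a b] c] d; rewrite /line/= !mul0r !addr0. Qed.

Variable g : C4 R -> CC R.
Hypothesis gc : {within @contr4 R, continuous g}.
Hypothesis gd : forall A r, contr4 A -> 0 <= r < 1 -> differentiable g (scale r A).

(* Along a line through a non-unitary contraction [A] that stays among the
   contractions, [|g| + e * frob] would have a maximum at [A], contradicting the
   mean value inequality since the restriction of [frob] is, up to the real
   part of a linear function, a positive multiple of [|z|^2]. *)
Lemma penalized_max_unit4 r e : 0 <= r < 1 -> 0 < e -> exists2 W, unit4 W &
  forall A, contr4 A ->
    normc (g (scale r A)) + e * frob A <= normc (g (scale r W)) + e * frob W.
Proof.
move=> r01 e0.
pose G A := normc (g (scale r A)) + e * frob A.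
have cG : {within @contr4 R, continuous G}.
  apply: continuous_in_subspaceT => A; rewrite inE => hA.
  have [/differentiable_continuous d1 /differentiable_continuous d2
    /differentiable_continuous d3 /differentiable_continuous d4] :=
    differentiable_c4 A.
  have csq (c : C4 R -> CC R) : {for A, continuous c} ->
      {for A, continuous (fun A => sqn (c A))}.
    move=> cc; exact: (@continuous_comp _ _ _ c _ A cc (@continuous_sqn R (c A))).
  have cs : {for A, continuous (scale r)}.
    have cm (c : C4 R -> CC R) : {for A, continuous c} ->
        {for A, continuous (fun A => (r%:C%C : CC R) * c A)}.
      move=> cc.
      exact: (@continuousM _ _ _ _ _ (@cst_continuous _ _ (r%:C%C : CC R) A) cc).
    exact: (continuous_pair (continuous_pair (continuous_pair (cm _ d1) (cm _ d2))
      (cm _ d3)) (cm _ d4)).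
  have cg := @continuous_comp _ _ _ (scale r) g A cs
    (differentiable_continuous (gd hA r01)).
  have cn := @continuous_comp _ _ _ (g \o scale r) _ A cg
    (@continuous_normc R (g (scale r A))).
  have cf := @continuousD _ R^o _ _ _ _
    (@continuousD _ R^o _ _ _ _ (csq _ d1) (csq _ d2))
    (@continuousD _ R^o _ _ _ _ (csq _ d3) (csq _ d4)).
  exact: (@continuousD _ R^o _ _ _ _ cn
    (@continuousM _ _ _ _ _ (@cst_continuous _ _ (e : R^o) A) cf)).
have ne : @contr4 R !=set0.
  exists (0, 0, 0, 0) => u v /=; rewrite !mul0r !addr0 /n2 sqn0 addr0.
  exact: n2_ge0.
have [A /set_mem hA maxA] := compact_EVT_max ne (@compact_contr4 R) cG.
have {}maxA B : contr4 B -> G B <= G A by move=> hB; apply: maxA; exact: mem_set.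
exists A; last exact: maxA.
have [h|[h|]] := contraction_perturbation hA.
- by apply: isometry_cols_unit4; left.
- by apply: isometry_cols_unit4; right.
move=> [b1 [b2 [b3 [b4 [b0 hB]]]]]; exfalso.
pose B : C4 R := (b1, b2, b3, b4).
have {}hB z : normc z <= 3^-1 -> contr4 (line A B z) by exact: hB.
(* The rotation [k] makes the value at [A] real and nonnegative, so a real part stands for [|g|] at
   the centre and is at most [|g|] elsewhere. *)
have [k k1 hk] := unimodular_rotation (g (scale r A)).
set m := normc (g (scale r A)) in hk.
pose S : R[i] := B`11 * (A`11 : R[i])^* + B`12 * (A`12 : R[i])^* +
               B`21 * (A`21 : R[i])^* + B`22 * (A`22 : R[i])^*.
(* The linear term reproduces the cross term of [e * frob] along the line. On the circle of radius
   [1/3] maximality then leaves [Re (h z) <= m - e * frob B / 9], while [Re (h 0) = m]. *)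
pose a : CC R := (2 * e)%:C%C * S.
pose h (z : CC R) : CC R := (k : CC R) * g (scale r (line A B z)) + z * a.
have /Re_mean_value_le : 0 < (3^-1 : R) by rewrite invr_gt0.
move=> /(_ h (m - e * (9^-1 * frob B))).
have h0 : Re (h 0) = m by rewrite /h line0 mul0r addr0 hk.
rewrite h0 => hh.
suff : m <= m - e * (9^-1 * frob B).
  have : 0 < e * (9^-1 * frob B) by rewrite mulr_gt0// mulr_gt0.
  lra.
apply: hh => z hz.
  apply/derivable1_diffP; apply: differentiableD; apply: differentiableM.
  - exact: differentiable_cst.
  - apply: (@differentiable_comp _ _ _ _ (fun z => scale r (line A B z)) g).
      exact: differentiable_scale_line.
    by apply: gd => //; exact: hB.
  - exact: ex_diff.
  - exact: differentiable_cst.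
have hz' : normc z <= 3^-1 by rewrite hz.
have := maxA _ (hB z hz'); rewrite /G frob_line -/m -/S => le1.
have sz : sqn z = 9^-1 by rewrite /sqn hz; lra.
rewrite sz in le1.
have Rza : Re (z * a) = e * (2 * Re (z * S)).
  rewrite /a mulrCA -[(2 * e)%:C%C]/((2 * e) +i* 0)%C; case: (z * S) => x y /=.
  by ring.
rewrite /h ReD Rza.
have le2 : Re (k * g (scale r (line A B z))) <= normc (g (scale r (line A B z))).
  apply: le_trans (ler_norm _) _; apply: le_trans (Re_le_normc _) _.
  by rewrite normcM k1 mul1r.
lra.
Qed.

Lemma continuous_scale : continuous (fun p : C4 R * R => scale p.2 p.1).
Proof.
move=> p.
have c1 : {for p, continuous (@fst (C4 R) R)} by exact: cvg_fst.
have c2 : {for p, continuous (@snd (C4 R) R)} by exact: cvg_snd.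
have cr : {for p, continuous (fun p : C4 R * R => (p.2%:C%C : CC R))}.
  exact: (@cvg_Complex _ _ _ (@snd (C4 R) R) (fun=> 0) _ _ _ c2 (@cst_continuous _ _ _ p)).
have [/differentiable_continuous d1 /differentiable_continuous d2
  /differentiable_continuous d3 /differentiable_continuous d4] :=
  differentiable_c4 p.1.
have cm (c : C4 R -> CC R) : {for p.1, continuous c} ->
    {for p, continuous (fun p : C4 R * R => (p.2%:C%C : CC R) * c p.1)}.
  move=> cc.
  exact: (@continuousM _ _ _ _ _ cr (@continuous_comp _ _ _ fst c p c1 cc)).
exact: (continuous_pair (continuous_pair (continuous_pair (cm _ d1) (cm _ d2))
  (cm _ d3)) (cm _ d4)).
Qed.

Lemma scale1 A : scale 1 A = A.
Proof. by case: A => -[[a b] c] d; rewrite /scale/= !mul1r. Qed.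

Lemma near_scale W e : contr4 W -> 0 < e ->
  \forall A \near W & r \near (1 : R), contr4 (scale r A) ->
    normc (g W - g (scale r A)) <= e.
Proof.
move=> hW e0.
have /subspace_continuousP/(_ W hW)/cvgrPdist_le/(_ e%:C%C) := gc.
rewrite ltcR => /(_ e0) nW.
have cs : (fun p : C4 R * R => scale p.2 p.1) @ (nbhs W, nbhs (1 : R)) --> W.
  by rewrite -[X in _ --> X]scale1; exact: (@continuous_scale (W, 1)).
have [[P Q] /= [PW Q1] hPQ] := cs _ nW.
exists (P, Q) => // -[A r] /= hAr hA.
have : `|g W - g (scale r A)| <= e%:C%C by exact: (hPQ (A, r) hAr hA).
by rewrite normE lecR.
Qed.

(** One [r0] serves all [W] by compactness of [unit4]; this is why [near_scale] is stated jointly in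
    the matrix and the ratio. *)
Lemma near_unit4_scale M e : 0 < e ->
  (forall W, unit4 W -> normc (g W) <= M) ->
  exists2 r0, r0 < 1 & forall r, r0 < r < 1 -> 0 <= r -> forall W, unit4 W ->
    normc (g (scale r W)) <= M + e.
Proof.
move=> e0 hM.
have /compact_near_coveringP/near_covering_withinP := @compact_unit4 R.
move=> /(_ R (nbhs (1 : R)) (fun r W => r < 1 -> 0 <= r ->
  normc (g (scale r W)) <= M + e) _) [].
  move=> W hW; have := near_scale (unit4_contr4 hW) e0.
  apply: filterS => -[V r] /= h hV r1 r0.
  have {}h : normc (g W - g (scale r V)) <= e.
    by apply: h; apply: contr4_scale; [rewrite r0 ltW|exact: unit4_contr4].
  have := le_normcD (g (scale r V) - g W) (g W); rewrite subrK.
  have := hM W hW; have : normc (g (scale r V) - g W) <= e.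
    by rewrite -normcN opprB.
  lra.
move=> d /= d0 hd; exists (1 - d) => [|r /andP[r1 r2] r0 W hW]; first by lra.
apply: (hd r _ W hW) => //=.
by rewrite /ball/= ger0_norm; lra.
Qed.

Lemma scale_cvg A e : contr4 A -> 0 < e -> exists2 r0, r0 < 1 &
  forall r, r0 < r < 1 -> 0 <= r -> normc (g A) <= normc (g (scale r A)) + e.
Proof.
move=> hA e0; have [[P Q] /= [PA [d /= d0 hd]] hPQ] := near_scale hA e0.
exists (1 - d) => [|r /andP[r1 r2] r0]; first by lra.
have := hPQ (A, r); rewrite /= => h.
have := le_normcD (g A - g (scale r A)) (g (scale r A)); rewrite subrK.
have : normc (g A - g (scale r A)) <= e; last by lra.
apply: h; first split; [exact: nbhs_singleton|apply: hd|].
  by rewrite /= ger0_norm; lra.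
by apply: contr4_scale => //; rewrite r0 ltW.
Qed.

Lemma unit4_maximum : exists2 W, unit4 W &
  forall A, contr4 A -> normc (g A) <= normc (g W).
Proof.
have ne : @unit4 R !=set0.
  exists (1, 0, - (0^* * 1), 1^* * 1), 1, 0, 1.
  by split=> //; rewrite /n2 ?sqn0 sqn1 ?addr0.
have cg : {within @unit4 R, continuous (fun A => normc (g A) : R)}.
  apply: (@continuous_subspaceW _ _ _ (@contr4 R)); first exact: unit4_contr4.
  apply/subspace_continuousP => A hA.
  have /subspace_continuousP/(_ A hA) cgA := gc.
  exact: (cvg_comp _ _ cgA (@continuous_normc R (g A))).
have [W /set_mem hW maxW] := compact_EVT_max ne (@compact_unit4 R) cg.
exists W => // A hA; apply/ler_addgt0Pr => e e0.
(* One quarter of [e] for each of the two passages from [r] to [1], and two for the penalty, since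
   [frob] is at most [2]. *)
have e30 : 0 < e / 4 by rewrite divr_gt0.
have [r1 r11 h1] := @near_unit4_scale (normc (g W)) (e / 4) e30
  (fun V hV => maxW V (mem_set hV)).
have [r2 r21 h2] := scale_cvg hA e30.
pose r := Num.max 0 (Num.max ((1 + r1) / 2) ((1 + r2) / 2)).
have r0 : 0 <= r by rewrite le_max lexx.
have rr1 : r1 < r by rewrite !lt_max; apply/orP; right; apply/orP; left; lra.
have rr2 : r2 < r by rewrite !lt_max; apply/orP; right; apply/orP; right; lra.
have r1' : r < 1 by rewrite !gt_max ltr01/=; apply/andP; split; lra.
have r01 : 0 <= r < 1 by rewrite r0.
have [V hV maxV] := penalized_max_unit4 r01 e30.
have k1 := h1 r; rewrite rr1 r1' in k1; have {}k1 := k1 isT r0 V hV.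
have k2 := h2 r; rewrite rr2 r1' in k2; have {}k2 := k2 isT r0.
have k3 := maxV A hA.
have f1 := frob_ge0 A; have f2 := contr4_frob (unit4_contr4 hV).
have p1 : 0 <= e / 4 * frob A by rewrite mulr_ge0// ltW.
have p2 : e / 4 * frob V <= e / 4 * 2 by rewrite ler_wpM2l// ltW.
lra.
Qed.

End MaximumPrinciple.

(** * Domains that are images of the matrix ball *)

Section ImageBoundary.
Variables (R : realType) (V : normedModType R[i]) (phi : C4 R -> V)
  (Omega : set V).
Hypothesis dphi : forall A, differentiable phi A.
Hypothesis Omega_phi : Omega `<=` phi @` @contr4 R.
Hypothesis phi_Omega : forall A r, contr4 A -> 0 <= r < 1 ->
  Omega (phi (scale r A)).

Lemma image_continuous : continuous phi.
Proof. by move=> A; exact: differentiable_continuous. Qed.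

Lemma image_compact_closed (X : set (C4 R)) : compact X -> closed (phi @` X).
Proof.
move=> cX; apply: compact_closed; first exact: norm_hausdorff.
by apply: continuous_compact => //; exact: continuous_subspaceT image_continuous.
Qed.

Lemma closure_image : closure Omega = phi @` @contr4 R.
Proof.
apply/seteqP; split.
  have cl := image_compact_closed (@compact_contr4 R).
  by rewrite [X in _ `<=` X]((closure_id _).1 cl); exact: closure_subset.
move=> _ [A hA <-] U nU.
have cs : (fun p : C4 R * R => scale p.2 p.1) @ (nbhs A, nbhs (1 : R)) --> A.
  by rewrite -[X in _ --> X]scale1; exact: (@continuous_scale _ (A, 1)).
have [[P Q] /= [PA [d /= d0 hd]] hPQ] := cs _ (@image_continuous A _ nU).
pose r := Num.max 0 (1 - d / 2).
have r0 : 0 <= r by rewrite le_max lexx.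
have r1 : r < 1 by rewrite gt_max ltr01/=; lra.
have rd : 1 - d / 2 <= r by rewrite le_max lexx orbT.
exists (phi (scale r A)); split; first by apply: phi_Omega => //; rewrite r0.
apply: (hPQ (A, r)); split=> /=; first exact: nbhs_singleton.
by apply: hd; rewrite /= ger0_norm; lra.
Qed.

(** Pulled back along [phi], a function of the algebra satisfies the hypotheses of
    [unit4_maximum]. *)
Lemma closed_boundary_image : closed_boundary Omega (phi @` @unit4 R).
Proof.
split.
- exact/image_compact_closed/compact_unit4.
- by rewrite closure_image; apply: image_subset; exact: unit4_contr4.
move=> f [fc fd].
have gc : {within @contr4 R, continuous (fun A => f (phi A))}.
  apply/subspace_continuousP => A hA.
  have hphi : closure Omega (phi A) by rewrite closure_image; exists A.
  have /subspace_continuousP/(_ _ hphi) cf := fc.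
  apply: cvg_comp cf => P nP.
  have h : nbhs A (phi @^-1` [set y | closure Omega y -> P y]).
    exact: (@image_continuous A _ nP).
  apply: (filterS _ h) => B hB cB; apply: hB.
  by rewrite closure_image; exists B.
have gd A r : contr4 A -> 0 <= r < 1 ->
    differentiable (fun A => f (phi A)) (scale r A).
  move=> hA r01; apply: (@differentiable_comp _ _ _ _ phi f); first exact: dphi.
  by apply: fd; exact: phi_Omega.
have [W hW maxW] := unit4_maximum gc gd.
exists (phi W); first by exists W.
rewrite closure_image => _ [A hA <-]; rewrite !normE lecR; exact: maxW.
Qed.

Lemma algebra_A_differentiable (f : V -> CC R) :
  (forall y, differentiable f y) -> algebra_A Omega f.
Proof.
move=> df; split=> [|y _]; last exact: df.
by apply: continuous_subspaceT => y; exact: differentiable_continuous.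
Qed.

End ImageBoundary.

Lemma shilov_boundaryE (R : realType) (V : normedModType R[i]) (Omega B : set V) :
  is_shilov_boundary Omega B -> shilov_boundary Omega = B.
Proof.
move=> hB; apply/seteqP; split=> [z [B' [_ hB'] B'z]|z Bz]; last by exists B.
by apply: hB' B'z; case: hB.
Qed.

(** * The tetrablock *)

Section TetrablockContractions.
Variable R : realType.
Implicit Types A B W : C4 R.
Implicit Types a b c d u v x y z : R[i].

Definition phiE A : C3 R := (A`11, A`22, A`11 * A`22 - A`12 * A`21).

Lemma differentiable_phiE A : differentiable phiE A.
Proof.
have [d1 d2 d3 d4] := differentiable_c4 A.
apply: differentiable_pair; first exact: differentiable_pair.
by apply: differentiableB; apply: differentiableM.
Qed.

Lemma scale_n2 A r u v : contr4 A -> 0 <= r ->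
  let B := scale r A in
  n2 (B`11 * u + B`12 * v) (B`21 * u + B`22 * v) <= r ^+ 2 * n2 u v.
Proof.
move=> hA r0; cbv zeta; rewrite /scale/=.
have E x y : r%:C%C * x * u + r%:C%C * y * v = r%:C%C * (x * u + y * v) by ring.
rewrite !E /n2 !sqnM -mulrDr.
have -> : sqn r%:C%C = r ^+ 2 by rewrite sqnRI/= expr0n/= addr0.
by rewrite ler_wpM2l ?sqr_ge0//; exact: hA.
Qed.

(** The polynomial of the tetrablock is [det (1 - B Z)] with [Z = diag (z1, z2)]. At a zero,
    [v = (b z2, 1 - a z1)] satisfies [B Z v = v], so [|v| <= r |v|] and [v = 0]; but [a z1 = 1]
    contradicts [|a| <= r < 1]. *)
Lemma phiE_scale A r : contr4 A -> 0 <= r < 1 -> tetrablock (phiE (scale r A)).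
Proof.
move=> hA /andP[r0 r1]; have hB u v := scale_n2 u v hA r0.
rewrite /phiE; set B := scale r A in hB *.
case: B hB => -[[a b] c] d /= hB z1 z2.
rewrite !normE !lecR -!sqn_le1 => hz1 hz2; apply/eqP => h0.
have r21 : r ^+ 2 < 1 by rewrite expr_lt1.
have := hB (z1 * (b * z2)) (z2 * (1 - a * z1)).
have -> : a * (z1 * (b * z2)) + b * (z2 * (1 - a * z1)) = b * z2 by ring.
have -> : c * (z1 * (b * z2)) + d * (z2 * (1 - a * z1)) = 1 - a * z1.
  by rewrite -[RHS]subr0 -h0; ring.
set v1 := b * z2; set v2 := 1 - a * z1 => k.
have k1 : n2 (z1 * v1) (z2 * v2) <= n2 v1 v2.
  by rewrite /n2 (sqnM z1) (sqnM z2); apply: lerD; apply: ler_piMl => //; exact: sqn_ge0.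
have k2 : n2 v1 v2 <= r ^+ 2 * n2 v1 v2.
  by apply: le_trans k _; rewrite ler_wpM2l// sqr_ge0.
have : n2 v1 v2 = 0.
  apply/eqP; rewrite eq_le n2_ge0 andbT leNgt; apply/negP => n0.
  by move: k2; rewrite leNgt gtr_pMl// r21.
move/eqP; rewrite paddr_eq0 ?sqn_ge0// !sqn_eq0 => /andP[_].
rewrite subr_eq0 => /eqP az; have := hB 1 0.
rewrite !mulr1 !mulr0 !addr0 /n2 sqn1 sqn0 addr0 mulr1 => ha.
have : sqn (a * z1) < 1.
  rewrite sqnM; apply: le_lt_trans r21; apply: (@le_trans _ _ (sqn a)).
    by rewrite ler_piMr// sqn_ge0.
  by apply: le_trans ha; rewrite lerDl sqn_ge0.
by rewrite -az sqn1 ltxx.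
Qed.

Lemma nonvanishing_lt u v :
  (forall z, normc z <= 1 -> u - z * v != 0) -> normc v < normc u.
Proof.
move=> h; rewrite ltNge; apply/negP => uv.
have [v0|v0] := eqVneq v 0.
  have u0 : u = 0.
    by apply: eq0_normc; apply/eqP; rewrite eq_le normc_ge0 andbT -(normc0 R) -v0.
  by have := h 0; rewrite normc0 ler01 u0 mul0r subrr eqxx => /(_ isT).
have nv : 0 < normc v.
  by rewrite lt_neqAle normc_ge0 andbT eq_sym; apply: contraNneq v0 => /eq0_normc->.
have := h (u / v); rewrite divfK// subrr eqxx => /(_ _)/negP; apply=> //.
by rewrite normcM normcV ler_pdivrMr// mul1r.
Qed.

Lemma tetrablock_swap x1 x2 x3 :
  tetrablock (x1, x2, x3) -> tetrablock (x2, x1, x3).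
Proof.
move=> h z1 z2 h1 h2; have := h z2 z1 h2 h1; rewrite /=.
by congr (_ != _); ring.
Qed.

(** With [z2 = k] unimodular the polynomial is affine in [z1] and has no root in the disc, so
    [|x1 - x3 k| < |1 - x2 k|]. Squaring gives the claim for the [k] that makes [k (x2 - x1^* x3)]
    real and nonnegative. *)
Lemma tetrablock_ineq x1 x2 x3 : tetrablock (x1, x2, x3) ->
  normc x1 < 1 /\
  2 * normc (x2 - x1^* * x3) < 1 + sqn x2 - sqn x1 - sqn x3.
Proof.
move=> h; split.
  rewrite -(normc1 R); apply: nonvanishing_lt => z z1.
  have := h z 0; rewrite /= !normE !lecR normc0 ler01 => /(_ z1 isT).
  by congr (_ != _); ring.
have [k k1 hk] := unimodular_rotation (x2 - x1^* * x3).
have : sqn (x1 - x3 * k) < sqn (1 - x2 * k).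
  rewrite /sqn ltr_sqr ?nnegrE ?normc_ge0//; apply: nonvanishing_lt => z z1.
  have := h z k; rewrite /= !normE !lecR k1 lexx => /(_ z1 isT).
  by congr (_ != _); ring.
have sk : sqn k = 1 by rewrite /sqn k1 expr1n.
have -> : sqn (1 - x2 * k) = sqn (x1 - x3 * k) + (1 + sqn x2 * sqn k - sqn x1 -
   sqn x3 * sqn k) - 2 * Re (k * (x2 - x1^* * x3)).
  set t := k * (x2 - _); apply: complexI.
  transitivity ((sqn (x1 - x3 * k))%:C%C + (1 + (sqn x2)%:C%C * (sqn k)%:C%C
    - (sqn x1)%:C%C - (sqn x3)%:C%C * (sqn k)%:C%C) - (t + t^*)).
    by rewrite !sqnE /t !conjE; ring.
  rewrite addJ; rewrite -!rmorphM -[1]/((1 : R)%:C%C) -!(rmorphB, rmorphD) //.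
rewrite hk sk !mulr1 -[Re (normc _)%:C%C]/(normc _); lra.
Qed.

Lemma psd_form (p q : R) t u v : 0 <= p -> 0 <= q -> sqn t <= p * q ->
  0 <= p * sqn u + q * sqn v + 2 * Re (t * (u^* * v)).
Proof.
move=> p0 q0 tpq.
have h1 : - (normc t * (normc u * normc v)) <= Re (t * (u^* * v)).
  have -> : normc t * (normc u * normc v) = normc (t * (u^* * v)).
    by rewrite !normcM; congr (_ * (_ * _)); case: u => ? ? /=; rewrite sqrrN.
  by have := Re_le_normc (t * (u^* * v)); rewrite ler_norml => /andP[].
have h2 : 2 * (normc t * (normc u * normc v)) <= p * sqn u + q * sqn v.
  have n1 : 0 <= 2 * (normc t * (normc u * normc v)).
    by do !apply: mulr_ge0 => //; exact: normc_ge0.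
  have n2 : 0 <= p * sqn u + q * sqn v.
    by apply: addr_ge0; apply: mulr_ge0 => //; exact: sqn_ge0.
  rewrite -ler_sqr ?nnegrE//.
  have -> : (2 * (normc t * (normc u * normc v))) ^+ 2 =
     4 * (sqn t * (sqn u * sqn v)) by rewrite /sqn; ring.
  apply: (@le_trans _ _ (4 * (p * q * (sqn u * sqn v)))).
    by rewrite ler_wpM2l// ler_wpM2r// mulr_ge0// sqn_ge0.
  by have := sqr_ge0 (p * sqn u - q * sqn v); lra.
lra.
Qed.

(** Positivity of [1 - A^* A] by its diagonal entries and its determinant, which equals
    [1 - tr (A^* A) + |det A|^2]. *)
Lemma contraction_criterion a b c d : n2 a c <= 1 -> n2 b d <= 1 ->
  n2 a c + n2 b d <= 1 + sqn (a * d - b * c) -> contraction a b c d.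
Proof.
move=> h1 h2 h3 u v; rewrite -subr_ge0.
pose t := - (a^* * b + c^* * d).
have -> : n2 u v - n2 (a * u + b * v) (c * u + d * v) =
    (1 - n2 a c) * sqn u + (1 - n2 b d) * sqn v + 2 * Re (t * (u^* * v)).
  set w := t * _; apply: complexI.
  transitivity ((1 - (n2 a c)%:C%C) * (sqn u)%:C%C +
    (1 - (n2 b d)%:C%C) * (sqn v)%:C%C + (w + w^*)).
    by rewrite rmorphB/= !n2E !sqnE /w /t !conjE; ring.
  by rewrite addJ -[1]/((1 : R)%:C%C) -!rmorphB -!rmorphM -!rmorphD.
apply: psd_form; rewrite ?subr_ge0//.
have <- : n2 a c * n2 b d - sqn (a * d - b * c) = sqn t.
  apply: complexI; rewrite rmorphB rmorphM/= !n2E !sqnE /t !conjE; ring.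
lra.
Qed.

(* The contraction is [(x1, b, b, x2)] with [b^2 = x1 x2 - x3]. *)
Lemma tetrablock_contr4 : @tetrablock R `<=` phiE @` @contr4 R.
Proof.
move=> [[x1 x2] x3] h.
have [X1 a1] := tetrablock_ineq h.
have [Y1 a2] := tetrablock_ineq (tetrablock_swap h).
pose m := x1 * x2 - x3.
(* The right side is positive by [tetrablock_ineq], which gives [2 |m| < |1 - P - Q + S|]. Without
   the outer modulus, [2 |m| <= 1 - P - Q + S] is the determinant condition of
   [contraction_criterion], so only the sign is missing. *)
have id : (1 - sqn x1 - sqn x2 + sqn x3) ^+ 2 - 4 * sqn m =
    (1 + sqn x2 - sqn x1 - sqn x3) ^+ 2 - 4 * sqn (x2 - x1^* * x3).
  have -> : sqn (x2 - x1^* * x3) = sqn x2 + sqn x1 * sqn x3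
      + (sqn m - sqn x1 * sqn x2 - sqn x3).
    apply: complexI; transitivity ((sqn x2)%:C%C + (sqn x1)%:C%C * (sqn x3)%:C%C +
      ((sqn m)%:C%C - (sqn x1)%:C%C * (sqn x2)%:C%C - (sqn x3)%:C%C)).
      by rewrite !sqnE /m !conjE; ring.
    by rewrite -!rmorphM -!rmorphB -!rmorphD.
  by ring.
set P := sqn x1 in a1 a2 id; set Q := sqn x2 in a1 a2 id.
set S := sqn x3 in a1 a2 id.
set y := normc (x2 - _) in a1; have y0 : 0 <= y := normc_ge0 _.
have y0' := normc_ge0 (x1 - x2^* * x3).
have sy : sqn (x2 - x1^* * x3) = y ^+ 2 by [].
pose n := normc m; have n0 : 0 <= n := normc_ge0 _.
have sm : sqn m = n ^+ 2 by [].
rewrite sy sm in id.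
have b2 : (2 * n) ^+ 2 < (1 - P - Q + S) ^+ 2.
  have : (2 * y) ^+ 2 < (1 + Q - P - S) ^+ 2.
    by rewrite ltr_sqr// nnegrE; lra.
  lra.
have S1 : S < 1 by lra.
have beta : 2 * n <= 1 - P - Q + S.
  have [b0|b0] := lerP 0 (1 - P - Q + S).
    by apply: ltW; rewrite -ltr_sqr// nnegrE; lra.
  exfalso.
  (* With [S >= (X Y - n)^2] the wrong sign would give [(1 - P)(1 - Q) + 2 n (1 - X Y) + n^2 < 0], a
     negative sum of nonnegative terms. *)
  have b3 : 2 * n < - (1 - P - Q + S).
    by rewrite -ltr_sqr ?nnegrE ?sqrrN//; lra.
  have PX : P = normc x1 ^+ 2 by []. have QY : Q = normc x2 ^+ 2 by [].
  have X0 := normc_ge0 x1; have Y0 := normc_ge0 x2.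
  set X := normc x1 in X0 X1 PX; set Y := normc x2 in Y0 Y1 QY.
  have XY : normc (x1 * x2) = X * Y by rewrite normcM.
  have t1 : X * Y - n <= normc x3.
    by have := le_normcD x3 m; rewrite /m addrC subrK XY -/m -/n; lra.
  have t2 : n - X * Y <= normc x3.
    by have := le_normcD (x1 * x2) (- x3); rewrite normcN XY -/m -/n; lra.
  have SXY : (X * Y - n) ^+ 2 <= S.
    rewrite -[(X * Y - n) ^+ 2]real_normK ?num_real// /S /sqn.
    by rewrite ler_sqr ?nnegrE ?normc_ge0// ler_norml; lra.
  have q1 : 0 <= (1 - P) * (1 - Q).
    by apply: mulr_ge0; rewrite subr_ge0 ?PX ?QY expr_le1// ltW.
  have q2 : 0 <= n * (1 - X * Y).
    by rewrite mulr_ge0// subr_ge0 mulr_ile1// ltW.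
  have q3 : 0 <= n ^+ 2 by exact: sqr_ge0.
  rewrite PX QY in q1 b3; lra.
pose b := sqrtc m.
have bb : b * b = m by rewrite -expr2 sqr_sqrtc.
have sb : sqn b = n by rewrite /sqn expr2 -normcM bb.
have detS : sqn (x1 * x2 - b * b) = S by rewrite bb /m opprB addrC subrK.
exists ((x1, b, b, x2) : C4 R); last first.
  by rewrite /phiE/= bb /m opprB addrC subrK.
(* The diagonal entries of [1 - A^* A] have positive sum and nonnegative product, so neither is
   negative. *)
have sum0 : 0 < (1 - (P + n)) + (1 - (n + Q)) by lra.
have prod0 : 0 <= (1 - (P + n)) * (1 - (n + Q)).
  have := sqn_ge0 (x1^* * b + b^* * x2).
  have -> : sqn (x1^* * b + b^* * x2) = n2 x1 b * n2 b x2 - S.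
    rewrite -detS; apply: complexI; rewrite [in RHS]rmorphB [in RHS]rmorphM/= !n2E !sqnE !conjE; ring.
  rewrite /n2 sb -/P -/Q; lra.
have d1 : 0 <= 1 - (P + n).
  rewrite leNgt; apply/negP => neg; move: prod0; rewrite leNgt => /negP; apply.
  by rewrite nmulr_rlt0//; lra.
have d2 : 0 <= 1 - (n + Q).
  rewrite leNgt; apply/negP => neg; move: prod0; rewrite leNgt => /negP; apply.
  by rewrite nmulr_llt0//; lra.
by apply: contraction_criterion => /=; rewrite ?detS /n2 sb -/P -/Q; lra.
Qed.

End TetrablockContractions.

Arguments phiE {R} A.

(** * Peak points of the tetrablock *)

Section TetrablockShilov.
Variable R : realType.
Implicit Types A B W : C4 R.
Implicit Types a b c d p u v x z t : R[i].

(** The equality case of the triangle inequality, read off from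
    [|m + t|^2 = m^2 + 2 m Re t + |t|^2]. *)
Lemma Re_ge_of_normc_add t (m : R) : 0 < m -> normc t <= m ->
  2 * m <= normc (m%:C%C + t) -> m <= Re t.
Proof.
move=> m0 tm h.
have : (2 * m) ^+ 2 <= normc (m%:C%C + t) ^+ 2.
  by rewrite ler_sqr ?nnegrE ?normc_ge0//; lra.
have t2 : normc t ^+ 2 <= m ^+ 2 by rewrite ler_sqr ?nnegrE ?normc_ge0//; lra.
move: t2; rewrite !normc_sqr; case: t {h tm} => x y /= t2.
rewrite add0r => h; rewrite -(ler_pM2l m0); lra.
Qed.

Lemma eq_real_of_Re_ge t (m : R) : normc t <= m -> m <= Re t -> t = m%:C%C.
Proof.
move=> h1 h2.
have m0 : 0 <= m := le_trans (normc_ge0 _) h1.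
have r : Re t = m.
  apply/eqP; rewrite eq_le h2 andbT; apply: le_trans h1.
  by apply: le_trans (Re_le_normc t); exact: ler_norm.
have : normc t ^+ 2 <= m ^+ 2 by rewrite ler_sqr ?nnegrE ?normc_ge0.
rewrite normc_sqr r gerDl => i2.
have : Im t ^+ 2 == 0 by rewrite eq_le i2 sqr_ge0.
by rewrite sqrf_eq0; case: t r {h1 h2 i2} => x y /= -> /eqP ->.
Qed.

Lemma phiE_unit4 (y : C3 R) : (phiE @` @unit4 R) y <->
  exists a p, [/\ sqn a <= 1, sqn p = 1 & y = (a, a^* * p, p)].
Proof.
split=> [[_ [a [b [p [p1 ab ->]]]] <-]|[a [p [a1 p1 ->]]]].
  exists a, p; split=> //; first by rewrite -ab lerDl sqn_ge0.
  rewrite /phiE/=; congr (_, _, _).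
  have e : a * a^* + b * b^* = 1 by rewrite -n2E ab.
  by rewrite -[RHS]mul1r -e; ring.
pose b : R[i] := (Num.sqrt (1 - sqn a))%:C%C.
have sb : sqn b = 1 - sqn a.
  by rewrite sqnRI/= expr0n/= addr0 sqr_sqrtr// subr_ge0.
have ab : n2 a b = 1 by rewrite /n2 sb; lra.
exists (a, b, - (b^* * p), a^* * p); first by exists a, b, p.
rewrite /phiE/=; congr (_, _, _).
have e : a * a^* + b * b^* = 1 by rewrite -n2E ab.
by rewrite -[RHS]mul1r -e; ring.
Qed.

(* For the class of a contraction, [|y3 - y1 y2| <= 1 - (|y1|^2 + |y2|^2) / 2], so
   the modulus of the second summand is at most
   [1 + |a|^2 - ((|y1| - |a|)^2 + (|y2| - |a|)^2) / 2]. *)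
Definition peakE a p (y : C3 R) : CC R :=
  (1 + sqn a)%:C%C + (a^* * y.1.1 + a * p^* * y.1.2
    + p^* * (y.2 - y.1.1 * y.1.2)).

Lemma differentiable_peakE a p (y : C3 R) : differentiable (peakE a p) y.
Proof.
have [d1 d2 d3] := differentiable_c3 y.
have dc k : differentiable (fun=> k : CC R) y by exact: differentiable_cst.
apply: differentiableD; first exact: dc.
apply: differentiableD.
  by apply: differentiableD; apply: differentiableM => //; exact: dc.
apply: differentiableM; first exact: dc.
by apply: differentiableB => //; exact: differentiableM.
Qed.

Lemma peakE_max a p A : sqn a <= 1 -> sqn p = 1 -> contr4 A ->
  normc (peakE a p (a, a^* * p, p)) <= normc (peakE a p (phiE A)) ->
  phiE A = (a, a^* * p, p).
Proof.
move=> a1 p1; case: A => -[[a' b'] c'] d' hA.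
have [r1 r2] := contraction_rows hA.
pose c := normc a; have c0 : 0 <= c := normc_ge0 a.
have ac : sqn a = c ^+ 2 by [].
have pp : p * p^* = 1 by rewrite -sqnE p1.
have np : normc p = 1.
  by apply/eqP; rewrite -(@eqrXn2 _ 2) ?normc_ge0// expr1n; apply/eqP.
pose m := 1 + c ^+ 2; have m0 : 0 < m by rewrite /m ltr_wpDr// sqr_ge0.
have cjn z : normc z^* = normc z by case: z => ? ? /=; rewrite sqrrN.
have -> : peakE a p (a, a^* * p, p) = (2 * m)%:C%C.
  rewrite /peakE/= ac -/m mulr_natl rmorphMn mulr2n; congr (_ + _).
  rewrite /m rmorphD/= -[c ^+ 2]ac sqnE rmorph1.
  have -> : a^* * a + a * p^* * (a^* * p) + p^* * (p - a * (a^* * p)) =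
     a * a^* + (p * p^*) by ring.
  by rewrite pp addrC.
have -> : normc (2 * m)%:C%C = 2 * m.
  by rewrite /= expr0n/= addr0 sqrtr_sqr ger0_norm//; lra.
rewrite /peakE/phiE/= ac -/m.
have -> : a' * d' - b' * c' - a' * d' = - (b' * c') by ring.
set t1 := a^* * a'; set t2 := a * p^* * d'; set t3 := p^* * _ => hm.
set X := normc a'; set Y := normc d'.
have X0 : 0 <= X := normc_ge0 _. have Y0 : 0 <= Y := normc_ge0 _.
have n1 : normc t1 = c * X by rewrite normcM cjn.
have n2' : normc t2 = c * Y by rewrite !normcM cjn np mulr1.
have n3 : normc t3 = normc b' * normc c' by rewrite normcM cjn np mul1r normcN normcM.
(* From [|b'| |c'| <= (|b'|^2 + |c'|^2) / 2] and the two row bounds. *)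
have q3 : normc t3 <= 1 - (X ^+ 2 + Y ^+ 2) / 2.
  move: r1 r2; rewrite n3 /n2/= -/X -/Y.
  have := sqr_ge0 (normc b' - normc c'); rewrite /sqn -/X -/Y; lra.
have s1 := sqr_ge0 (X - c); have s2 := sqr_ge0 (Y - c).
have nT : normc (t1 + t2 + t3) <= m.
  apply: le_trans (le_normcD _ _) _; apply: le_trans (lerD (le_normcD _ _) (lexx _)) _.
  rewrite n1 n2' /m; lra.
have := Re_ge_of_normc_add m0 nT hm; rewrite !ReD => hR.
have Rle z : Re z <= normc z.
  by apply: le_trans (Re_le_normc z); exact: ler_norm.
(* The real parts add up to at least [m], their bounds to [m] minus half the two squares: the
   squares vanish, and each summand equals its bound. *)
have := Rle t1; have := Rle t2; have := Rle t3; rewrite n1 n2' => R3 R2 R1.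
have Xc : X = c.
  apply/eqP; rewrite -subr_eq0 -sqrf_eq0 eq_le s1 andbT; rewrite /m in hR; lra.
have Yc : Y = c.
  apply/eqP; rewrite -subr_eq0 -sqrf_eq0 eq_le s2 andbT; rewrite /m in hR; lra.
rewrite Xc Yc in n1 n2' q3 R1 R2.
have e1 : t1 = (c * c)%:C%C.
  by apply: eq_real_of_Re_ge; [rewrite n1|rewrite /m in hR; lra].
have e2 : t2 = (c * c)%:C%C.
  by apply: eq_real_of_Re_ge; [rewrite n2'|rewrite /m in hR; lra].
have e3 : t3 = (1 - c * c)%:C%C.
  by apply: eq_real_of_Re_ge; rewrite /m in hR; lra.
have cc : (c * c)%:C%C = a * a^* by rewrite -sqnE ac expr2.
have ea : a' = a.
  have [a0|a0] := eqVneq a 0.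
    rewrite a0; apply: eq0_normc; rewrite -/X Xc /c a0 normc0 //.
  have aj : a^* != 0 by rewrite conjC_eq0.
  by apply: (mulfI aj); rewrite -/t1 e1 cc mulrC.
have ed : d' = a^* * p.
  have [a0|a0] := eqVneq a 0.
    rewrite a0 conj0 mul0r; apply: eq0_normc; rewrite -/Y Yc /c a0 normc0 //.
  apply: (mulfI a0); rewrite mulrA -cc -e2 /t2.
  by rewrite -[LHS]mulr1 -pp; ring.
congr (_, _, _) => //.
have e3' : - (b' * c') = p - a * a^* * p.
  rewrite -[LHS]mulr1 -pp.
  have -> : - (b' * c') * (p * p^*) = t3 * p by rewrite /t3; ring.
  rewrite e3; have -> : (1 - c * c)%:C%C = 1 - a * a^* by rewrite -cc rmorphB rmorph1.
  by ring.
by rewrite ea ed e3'; ring.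
Qed.

Lemma tetrablock_shilov : is_shilov_boundary (@tetrablock R) (phiE @` @unit4 R).
Proof.
have hE := @tetrablock_contr4 R; have hS := @phiE_scale R.
split.
  by apply: closed_boundary_image => //; exact: differentiable_phiE.
move=> B [cB subB maxB] k /phiE_unit4[a [p [a1 p1 ->]]].
have [z Bz hz] := maxB (peakE a p) (algebra_A_differentiable _
  (differentiable_peakE a p)).
have cl := closure_image (@differentiable_phiE R) hE hS.
have := subB z Bz; rewrite cl => -[A hA Az].
rewrite -(peakE_max a1 p1 hA) ?Az//.
rewrite -lecR -!normE; apply: hz; rewrite cl.
have : (phiE @` @unit4 R) (a, a^* * p, p) by apply/phiE_unit4; exists a, p.
by apply: image_subset; exact: unit4_contr4.
Qed.

End TetrablockShilov.

(** * The domain F *)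

Section DomainF.
Variable R : realType.
Implicit Types A B W : C4 R.
Implicit Types a b c d p u v x z t : R[i].

(** Source and target share the type [C4 R]: on a point of F the matrix notations select the
    coordinates [a11], [a22], [det A] and [a12 + a21], in this order. *)
Definition phiF A : C4 R :=
  (A`11, A`22, A`11 * A`22 - A`12 * A`21, A`12 + A`21).

Lemma differentiable_phiF A : differentiable phiF A.
Proof.
have [d1 d2 d3 d4] := differentiable_c4 A.
apply: differentiable_pair; last exact: differentiableD.
apply: differentiable_pair; first exact: differentiable_pair.
by apply: differentiableB; apply: differentiableM.
Qed.

Lemma det_mx2 (M : 'M[R[i]]_2) : \det M = M 0 0 * M 1 1 - M 0 1 * M 1 0.
Proof.
have o1 : lift ord0 ord0 = 1 :> 'I_2 by apply/val_inj.
have o0 : lift 1 ord0 = 0 :> 'I_2 by apply/val_inj.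
rewrite (expand_det_row _ 0) !big_ord_recl big_ord0 /cofactor !det_mx11 !mxE.
by rewrite !o1 ?o0/= !addn0 ?add0n expr0 expr1 mul1r mulN1r mulrN addr0.
Qed.

Lemma l2norm2 (v : 'cV[R[i]]_2) : l2norm v = Num.sqrt (n2 (v 0 0) (v 1 0)).
Proof. by rewrite /l2norm big_ord_recl big_ord1; congr (Num.sqrt (_ + sqn (v _ _))); apply/val_inj. Qed.

Lemma l2norm_mul (M : 'M[R[i]]_2) (v : 'cV[R[i]]_2) : l2norm (M *m v) =
  Num.sqrt (n2 (M 0 0 * v 0 0 + M 0 1 * v 1 0) (M 1 0 * v 0 0 + M 1 1 * v 1 0)).
Proof.
have o1 : lift ord0 ord0 = 1 :> 'I_2 by apply/val_inj.
by rewrite l2norm2 !mxE !big_ord_recl !big_ord0 !addr0 o1.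
Qed.

(** The Frobenius norm is an upper bound. This ensures that the [sup] in [opnorm] is a true supremum
    and not its default value. *)
Lemma opnorm_has_sup (M : 'M[R[i]]_2) :
  has_sup [set l2norm (M *m v) | v in [set v | l2norm v <= 1]].
Proof.
have z1 : l2norm (0 : 'cV[R[i]]_2) <= 1.
  by rewrite l2norm2 !mxE /n2 sqn0 addr0 sqrtr0.
split; first by exists (l2norm (M *m 0)); exists 0.
exists (Num.sqrt (n2 (M 0 0) (M 0 1) + n2 (M 1 0) (M 1 1))) => _ [v v1 <-].
rewrite l2norm_mul; apply: ler_wsqrtr.
move: v1; rewrite /= l2norm2 -sqrtr1 ler_sqrt// => v1.
have row a b : sqn (a * v 0 0 + b * v 1 0) <= n2 a b.
  have := sqn_dot_le a b (v 0 0)^* (v 1 0)^*.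
  rewrite !conjCK /n2 !sqn_conj => h; apply: le_trans h _.
  by rewrite ler_piMr// addr_ge0// sqn_ge0.
exact: lerD.
Qed.

Lemma opnorm_contraction (M : 'M[R[i]]_2) : opnorm M < 1 ->
  contraction (M 0 0) (M 0 1) (M 1 0) (M 1 1).
Proof.
move=> M1 u v.
have [n0|n0] := eqVneq (n2 u v) 0.
  move/eqP: n0; rewrite paddr_eq0 ?sqn_ge0// !sqn_eq0 => /andP[/eqP-> /eqP->].
  by rewrite !mulr0 addr0.
have np : 0 < n2 u v by rewrite lt_neqAle eq_sym n0 n2_ge0.
pose k := (Num.sqrt (n2 u v))^-1; pose kC : R[i] := k%:C%C.
have kk : sqn kC * n2 u v = 1.
  by rewrite sqnRI/= expr0n/= addr0 exprVn sqr_sqrtr ?n2_ge0// mulVf.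
pose w : 'cV[R[i]]_2 := \col_i (if i == 0 then kC * u else kC * v).
have w0 : w 0 0 = kC * u by rewrite mxE.
have w1 : w 1 0 = kC * v by rewrite mxE.
have nw : l2norm w <= 1.
  by rewrite l2norm2 w0 w1 /n2 !sqnM -mulrDr kk sqrtr1.
have := sup_upper_bound (opnorm_has_sup M) (ex_intro2 _ _ w nw erefl).
rewrite -/(opnorm M) => h; have {}h := le_trans h (ltW M1).
move: h; rewrite l2norm_mul w0 w1 -[X in _ <= X]sqrtr1 ler_sqrt//.
have E x y : x * (kC * u) + y * (kC * v) = kC * (x * u + y * v) by ring.
rewrite !E /n2 !sqnM -mulrDr -kk ler_pM2l//.
by rewrite lt_neqAle sqn_ge0 andbT eq_sym; apply/eqP => k0;
  move: kk; rewrite k0 mul0r => /eqP; rewrite eq_sym oner_eq0.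
Qed.

Lemma domainF_contr4 : @domainF R `<=` phiF @` @contr4 R.
Proof.
move=> _ [M /= M1 <-].
exists ((M 0 0, M 0 1, M 1 0, M 1 1) : C4 R); first exact: opnorm_contraction.
by rewrite /phiF/= det_mx2.
Qed.

Lemma phiF_scale A r : contr4 A -> 0 <= r < 1 -> domainF (phiF (scale r A)).
Proof.
move=> hA /andP[r0 r1]; set B := scale r A.
pose M : 'M[R[i]]_2 := \matrix_(i, j)
  (if i == 0 then if j == 0 then B`11 else B`12
   else if j == 0 then B`21 else B`22).
exists M; last by rewrite det_mx2 !mxE.
rewrite /=; apply: le_lt_trans r1; apply: ge_sup.
  by have [] := opnorm_has_sup M.
move=> _ [v v1 <-]; rewrite l2norm_mul !mxE/=.
move: v1; rewrite /= l2norm2 -sqrtr1 ler_sqrt// => v1.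
rewrite -[X in _ <= X](ger0_norm r0) -sqrtr_sqr.
have := scale_n2 (v 0 0) (v 1 0) hA r0; cbv zeta; rewrite -/B => h.
apply: ler_wsqrtr; apply: le_trans h _.
by rewrite ler_piMr// sqr_ge0.
Qed.

End DomainF.
Arguments phiF {R} A.

(** * Peaking on F modulo transposition *)

Section DomainFShilov.
Variable R : realType.
Implicit Types A B W y : C4 R.
Implicit Types u v x z t : R[i].

Definition transpose4 A : C4 R := (A`11, A`21, A`12, A`22).

(** The transpose is the entrywise conjugate of the adjoint. *)
Lemma transpose4_contr4 A : contr4 A -> contr4 (transpose4 A).
Proof.
case: A => -[[a b] c] d /contraction_adjoint h u v /=.
have := h u^* v^*; rewrite -!conjM -!conjD /n2 !sqn_conj.
by rewrite /transpose4/=.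
Qed.

Lemma phiF_transpose4 A : phiF (transpose4 A) = phiF A.
Proof. by rewrite /phiF/=; congr (_, _, _, _); ring. Qed.

Variables a b p : R[i].
Hypothesis p1 : sqn p = 1.
Hypothesis ab1 : n2 a b = 1.

Let U : C4 R := (a, b, - (b^* * p), a^* * p).

(* [(2 + tr (U^* A)) / 4] *)
Definition peak_factor A : R[i] :=
  (2 + (a^* * A`11 + b^* * A`12 + - (b * p^*) * A`21 + a * p^* * A`22)) / 4.

(* The sum and the product of [peak_factor] at a matrix and at its transpose,
   in the coordinates of [phiF]. *)
Definition factor_sum y : CC R :=
  4^-1 * (4 + 2 * (a^* * y`11 + a * p^* * y`12) + (b^* - b * p^*) * y`22).

Definition factor_prod y : CC R :=
  16^-1 * (4 + 4 * (a^* * y`11 + a * p^* * y`12) + 2 * ((b^* - b * p^*) * y`22)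
    + (a^* * y`11 + a * p^* * y`12) * (a^* * y`11 + a * p^* * y`12)
    + (a^* * y`11 + a * p^* * y`12) * ((b^* - b * p^*) * y`22)
    + (b^* + b * p^*) * (b^* + b * p^*) * (y`11 * y`12 - y`21)
    - b * b^* * p^* * (y`22 * y`22)).

Lemma factor_sumE A :
  factor_sum (phiF A) = peak_factor A + peak_factor (transpose4 A).
Proof. by rewrite /factor_sum /peak_factor /=; field. Qed.

(** With [k = b^*] and [l = - b p^*], the off-diagonal parts [k a12 + l a21] and [k a21 + l a12]
    have product [k l (a12 + a21)^2 + (k - l)^2 a12 a21], and [a12 a21 = a11 a22 - det A]. *)
Lemma factor_prodE A :
  factor_prod (phiF A) = peak_factor A * peak_factor (transpose4 A).
Proof. by rewrite /factor_prod /peak_factor /=; field. Qed.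

(** Newton's recurrence for the power sums of two numbers with given sum and product, which exhibits
    them as polynomials on F. *)
Fixpoint power_sum (n : nat) (y : C4 R) : CC R :=
  match n with
  | 0%N => 2
  | n1.+1 => match n1 with
    | 0%N => factor_sum y
    | n0.+1 => factor_sum y * power_sum n1 y - factor_prod y * power_sum n0 y
    end
  end.

Lemma power_sumE n A : power_sum n (phiF A) =
  peak_factor A ^+ n + peak_factor (transpose4 A) ^+ n.
Proof.
suff : power_sum n (phiF A) = peak_factor A ^+ n + peak_factor (transpose4 A) ^+ n
  /\ power_sum n.+1 (phiF A) =
     peak_factor A ^+ n.+1 + peak_factor (transpose4 A) ^+ n.+1 by case.
elim: n => [|n [IH1 IH2]].
  by split; rewrite /= ?factor_sumE ?expr1// !expr0.
split=> //.
have -> : power_sum n.+2 (phiF A) = factor_sum (phiF A) * power_sum n.+1 (phiF A)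
  - factor_prod (phiF A) * power_sum n (phiF A) by [].
by rewrite IH1 IH2 factor_sumE factor_prodE !exprS; ring.
Qed.

Lemma differentiable_power_sum n y : differentiable (power_sum n) y.
Proof.
have [d1 d2 d3 d4] := differentiable_c4 y.
have dc (k : CC R) : differentiable (fun _ : C4 R => k) y.
  exact: differentiable_cst.
have dM (f g : C4 R -> CC R) : differentiable f y -> differentiable g y ->
    differentiable (fun y => f y * g y) y by move=> *; exact: differentiableM.
have dD (f g : C4 R -> CC R) : differentiable f y -> differentiable g y ->
    differentiable (fun y => f y + g y) y by move=> *; exact: differentiableD.
have dB (f g : C4 R -> CC R) : differentiable f y -> differentiable g y ->
    differentiable (fun y => f y - g y) y by move=> *; exact: differentiableB.
have dL : differentiable (fun y : C4 R => a^* * y`11 + a * p^* * y`12 : CC R) y.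
  by apply: dD; apply: dM.
have dS : differentiable (fun y : C4 R => (b^* - b * p^*) * y`22 : CC R) y.
  exact: dM.
have d_sum : differentiable factor_sum y.
  exact: (dM _ _ (dc _) (dD _ _ (dD _ _ (dc _) (dM _ _ (dc _) dL)) dS)).
have d_prod : differentiable factor_prod y.
  exact: (dM _ _ (dc _) (dB _ _ (dD _ _ (dD _ _ (dD _ _ (dD _ _ (dD _ _ (dc _)
    (dM _ _ (dc _) dL)) (dM _ _ (dc _) dS)) (dM _ _ dL dL)) (dM _ _ dL dS))
    (dM _ _ (dc _) (dB _ _ (dM _ _ d1 d2) d3))) (dM _ _ (dc _) (dM _ _ d4 d4)))).
suff : differentiable (power_sum n) y /\ differentiable (power_sum n.+1) y by case.
elim: n => [|n [IH1 IH2]]; first by split; [exact: dc|exact: d_sum].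
split; first exact: IH2.
exact: (dB _ _ (dM _ _ d_sum IH2) (dM _ _ d_prod IH1)).
Qed.

(** Cauchy-Schwarz for each row of [A] against the same row of [U], both of norm at most [1]. *)
Lemma trace_rows A : contr4 A ->
  normc (a^* * A`11 + b^* * A`12 + - (b * p^*) * A`21 + a * p^* * A`22) <= 2.
Proof.
move=> /contraction_rows[r1 r2].
have row u v x z : n2 u v <= 1 -> n2 x z <= 1 -> normc (u * x^* + v * z^*) <= 1.
  move=> h1 h2; rewrite -sqn_le1; apply: le_trans (sqn_dot_le _ _ _ _) _.
  by rewrite mulr_ile1// n2_ge0.
have -> : a^* * A`11 + b^* * A`12 + - (b * p^*) * A`21 + a * p^* * A`22 =
  (A`11 * a^* + A`12 * b^*) + (A`21 * (- (b^* * p))^* + A`22 * (a^* * p)^*).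
  by rewrite !conjE; ring.
apply: le_trans (le_normcD _ _) _; rewrite -[2]/(1 + 1 : R).
apply: lerD; apply: row => //; first by rewrite ab1.
have -> : n2 (- (b^* * p)) (a^* * p) = n2 a b; last by rewrite ab1.
by rewrite /n2 sqnN !sqnM p1 !mulr1 !sqn_conj addrC.
Qed.

Lemma normc_nat (n : nat) : normc (n%:R : R[i]) = n%:R.
Proof.
have -> : n%:R = (n%:R)%:C%C :> R[i] by rewrite rmorph_nat.
by rewrite /= expr0n/= addr0 sqrtr_sqr ger0_norm.
Qed.

(** With [t = tr (U^* A)], [|2 + t| >= 4] and [|t| <= 2] force [Re t >= 2]; then the squared
    Frobenius distance [|A|^2 + |U|^2 - 2 Re t] is at most [2 + 2 - 4]. *)
Lemma peak_factor_eq A : contr4 A -> 1 <= normc (peak_factor A) -> A = U.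
Proof.
move=> hA h; have := trace_rows hA; move: h; rewrite /peak_factor.
set t := _ + _ + _ + _ => h1 ht.
rewrite normcM normcV normc_nat ler_pdivlMr// mul1r in h1.
have Ret : 2 <= Re t.
  apply: Re_ge_of_normc_add ht _ => //.
  by rewrite rmorph_nat; lra.
have fA := contr4_frob hA.
have fU : frob U = 2.
  rewrite /frob /U/= ab1.
  have -> : n2 (- (b^* * p)) (a^* * p) = n2 a b; last by rewrite ab1.
  by rewrite /n2 sqnN !sqnM p1 !mulr1 !sqn_conj addrC.
pose D : C4 R := (A`11 - a, A`12 - b, A`21 + b^* * p, A`22 - a^* * p).
have fD : frob D = frob A + frob U - 2 * Re t.
  apply: complexI; transitivity ((frob A)%:C%C + (frob U)%:C%C - (t + t^*)).
    have fE B : (frob B)%:C%C = B`11 * (B`11 : R[i])^* + B`12 * (B`12 : R[i])^*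
      + (B`21 * (B`21 : R[i])^* + B`22 * (B`22 : R[i])^*).
      by rewrite rmorphD/= !n2E.
    by rewrite !fE /D /U /t/= !conjE; ring.
  by rewrite addJ -!rmorphD -!rmorphB.
have : frob D = 0.
  by apply/eqP; rewrite eq_le frob_ge0 andbT fD fU; lra.
move/eqP; rewrite paddr_eq0 ?n2_ge0// !paddr_eq0 ?sqn_ge0// !sqn_eq0/=.
rewrite !subr_eq0 addr_eq0 => /andP[/andP[/eqP h11 /eqP h12] /andP[/eqP h21 /eqP h22]].
by case: A h11 h12 h21 h22 {hA h1 ht Ret fA D fD t} => -[[? ?] ?] ? /= -> -> -> ->.
Qed.

Lemma peak_factorU : peak_factor U = 1.
Proof.
have pp : p * p^* = 1 by rewrite -sqnE p1.
have ab : a * a^* + b * b^* = 1 by rewrite -n2E ab1.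
rewrite /peak_factor/=.
have -> : a^* * a + b^* * b + - (b * p^*) * - (b^* * p) + a * p^* * (a^* * p) =
  (a * a^* + b * b^*) * (1 + p * p^*) by ring.
by rewrite ab pp; field.
Qed.

(** Here the trace is [2 |a|^2 - 2 Re (b^2 p^* )], a real number at least [-2]. Hence [power_sum n]
    has modulus at least [1] at the class of [U] for every [n]. *)
Lemma peak_factor_transposeU :
  exists2 r : R, 0 <= r & peak_factor (transpose4 U) = r%:C%C.
Proof.
have pp : p * p^* = 1 by rewrite -sqnE p1.
pose w := b * b * p^*.
have nw : normc w = sqn b.
  have : sqn w = sqn b ^+ 2 by rewrite /w !sqnM sqn_conj p1 mulr1 expr2.
  by move/eqP; rewrite eqrXn2 ?normc_ge0 ?sqn_ge0// => /eqP.
exists ((2 + (2 * sqn a - 2 * Re w)) / 4).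
  apply: divr_ge0 => //; have := Re_le_normc w; rewrite nw ler_norml => /andP[_ h].
  have := sqn_ge0 a; have : sqn a + sqn b = 1 by []; lra.
rewrite /peak_factor/=.
have -> : a^* * a + b^* * - (b^* * p) + - (b * p^*) * b + a * p^* * (a^* * p) =
   (2 * sqn a - 2 * Re w)%:C%C.
  transitivity (2 * (sqn a)%:C%C - (w + w^*)); last first.
    have -> : 2 = (2 : R)%:C%C :> R[i] by rewrite rmorph_nat.
    by rewrite addJ -rmorphM -rmorphB.
  rewrite sqnE /w !conjE.
  have -> : a * p^* * (a^* * p) = (a * a^*) * (p * p^*) by ring.
  by rewrite pp; ring.
have c2 : 2 = (2 : R)%:C%C :> R[i] by rewrite rmorph_nat.
have c4 : 4 = (4 : R)%:C%C :> R[i] by rewrite rmorph_nat.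
by rewrite c2 c4 -rmorphD -fmorphV -rmorphM.
Qed.

Lemma normc_power_sum n : 1 <= normc (power_sum n (phiF U)).
Proof.
rewrite power_sumE peak_factorU expr1n; have [r r0 ->] := peak_factor_transposeU.
have -> : 1 + r%:C%C ^+ n = (1 + r ^+ n)%:C%C :> R[i].
  by rewrite rmorphD rmorph1 rmorphXn.
rewrite /= expr0n/= addr0 sqrtr_sqr.
by rewrite ger0_norm ?addr_ge0 ?exprn_ge0// lerDl exprn_ge0.
Qed.

Lemma continuous_peak_factor : continuous (peak_factor : C4 R -> CC R).
Proof.
move=> A; apply: differentiable_continuous.
have [d1 d2 d3 d4] := differentiable_c4 A.
have dc (k : CC R) : differentiable (fun _ : C4 R => k) A.
  exact: differentiable_cst.
have dM (f g : C4 R -> CC R) : differentiable f A -> differentiable g A ->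
    differentiable (fun y => f y * g y) A by move=> *; exact: differentiableM.
have dD (f g : C4 R -> CC R) : differentiable f A -> differentiable g A ->
    differentiable (fun y => f y + g y) A by move=> *; exact: differentiableD.
exact: (dM _ _ (dD _ _ (dc _) (dD _ _ (dD _ _ (dD _ _ (dM _ _ (dc _) d1)
  (dM _ _ (dc _) d2)) (dM _ _ (dc _) d3)) (dM _ _ (dc _) d4))) (dc _)).
Qed.

(** If [B] missed the class of [U], [peak_factor] would have modulus at most some [r < 1] on the
    compact set [X] of contractions over [B], which is stable under transposition. Then
    [|power_sum n| <= 2 r^n < 1] on [B] for large [n], against the value at [U]. *)
Lemma unitary_in_boundary (B : set (C4 R)) : closed_boundary (@domainF R) B -> B (phiF U).
Proof.
move=> [cB subB maxB]; apply: contrapT => NB.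
have cl := closure_image (@differentiable_phiF R) (@domainF_contr4 R) (@phiF_scale R).
pose X := @contr4 R `&` (phiF @^-1` B).
have cX : compact X.
  apply: compact_closedI; first exact: compact_contr4.
  apply: preimage_closed => // A _; exact/differentiable_continuous/differentiable_phiF.
have XB (z : C4 R) : B z -> exists2 A, X A & phiF A = z.
  move=> Bz; have := subB z Bz; rewrite cl => -[A hA Az].
  by exists A => //; split=> //=; rewrite Az.
have hU : contr4 U by exact: contraction_unit.
have UF : closure (@domainF R) (phiF U) by rewrite cl; exists U.
have bnd n : exists2 A, X A &
    1 <= normc (peak_factor A) ^+ n + normc (peak_factor (transpose4 A)) ^+ n.
  have [z Bz hz] := maxB (power_sum n) (algebra_A_differentiable _
    (differentiable_power_sum n)).
  have [A XA Az] := XB z Bz; exists A => //.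
  have := hz _ UF; rewrite !normE lecR -Az (power_sumE n A) => h.
  apply: le_trans (le_trans (normc_power_sum n) h) _.
  apply: le_trans (le_normcD _ _) _; rewrite le_eqVlt; apply/orP; left; apply/eqP.
  have nX z' m : normc (z' ^+ m) = normc z' ^+ m.
    by elim: m => [|m IH]; rewrite ?expr0 ?normc1// !exprS normcM IH.
  by rewrite !nX.
have [A0 XA0 _] := bnd 0%N.
have cg : {within X, continuous (fun A => normc (peak_factor A) : R)}.
  apply: continuous_subspaceT => A.
  exact: (cvg_comp _ _ (@continuous_peak_factor A)
    (@continuous_normc R (peak_factor A))).
have [M /set_mem XM maxM] := compact_EVT_max (ex_intro _ A0 XA0) cX cg.
pose r := normc (peak_factor M).
have r1 : r < 1.
  rewrite ltNge; apply/negP => /(peak_factor_eq XM.1) MU.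
  by apply: NB; rewrite -MU; exact: XM.2.
have r0 : 0 <= r := normc_ge0 _.
have /cvgrPdist_lt/(_ (1 / 2)) : GRing.exp r n @[n --> \oo] --> (0 : R).
  by apply: cvg_expr; rewrite ger0_norm.
move=> /(_ ltac:(lra))[n _ /(_ n (leqnn n))].
rewrite sub0r normrN ger0_norm ?exprn_ge0// => hn.
have [A XA] := bnd n.
have XtA : X (transpose4 A).
  split; first exact: transpose4_contr4 XA.1.
  by rewrite /= phiF_transpose4; exact: XA.2.
have k1 : normc (peak_factor A) ^+ n <= r ^+ n.
  by rewrite lerXn2r ?nnegrE ?normc_ge0//; apply: maxM; exact: mem_set.
have k2 : normc (peak_factor (transpose4 A)) ^+ n <= r ^+ n.
  by rewrite lerXn2r ?nnegrE ?normc_ge0//; apply: maxM; exact: mem_set.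
lra.
Qed.

End DomainFShilov.

Lemma domainF_shilov (R : realType) :
  is_shilov_boundary (@domainF R) (phiF @` @unit4 R).
Proof.
split.
  apply: closed_boundary_image; [exact: differentiable_phiF|
    exact: domainF_contr4|exact: phiF_scale].
move=> B hB _ [_ [a [b [p [p1 ab ->]]]] <-].
exact: unitary_in_boundary.
Qed.

(** * Parametrizations of the distinguished boundaries *)

Section Parametrizations.
Variable R : realType.
Implicit Types a b p s w x z e : R[i].

Lemma sqn_expi (t : R) : sqn (expi t) = 1.
Proof. by rewrite sqnRI cos2Dsin2. Qed.

Lemma expi_conj (t : R) : expi t * (expi t)^* = 1.
Proof. by rewrite -sqnE sqn_expi. Qed.

Lemma expi_double (t : R) : expi (2 * t) = expi t * expi t.
Proof.
rewrite mulr_natl mulr2n /expi cosD sinD; apply/eqP; rewrite eq_complex/=.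
by apply/andP; split; apply/eqP; ring.
Qed.

Lemma expi_surj z : sqn z = 1 -> exists t : R, z = expi t.
Proof.
case: z => c s; rewrite sqnRI/= => cs.
have cI : -1 <= c <= 1.
  rewrite -ler_norml -ler_sqr ?nnegrE// real_normK ?num_real// expr1n -cs.
  by rewrite lerDl sqr_ge0.
have ss : 1 - c ^+ 2 = s ^+ 2 by lra.
have [s0|s0] := lerP 0 s.
  exists (acos c); rewrite /expi acosK// sin_acos// ss sqrtr_sqr.
  by rewrite ger0_norm.
exists (- acos c); rewrite /expi cosN sinN acosK// sin_acos// ss sqrtr_sqr.
by rewrite ltr0_norm// opprK.
Qed.

Lemma phiF_unit4 (y : C4 R) : (phiF @` @unit4 R) y <->
  exists a b p, [/\ n2 a b = 1, sqn p = 1 & y = (a, a^* * p, p, b - b^* * p)].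
Proof.
have E a b p : n2 a b = 1 -> phiF (a, b, - (b^* * p), a^* * p) =
    (a, a^* * p, p, b - b^* * p).
  move=> ab; rewrite /phiF/=; congr (_, _, _, _).
  have e : a * a^* + b * b^* = 1 by rewrite -n2E ab.
  by rewrite -[RHS]mul1r -e; ring.
split=> [[_ [a [b [p [p1 ab ->]]]] <-]|[a [b [p [ab p1 ->]]]]].
  by exists a, b, p; rewrite E.
by exists (a, b, - (b^* * p), a^* * p); [exists a, b, p|rewrite E].
Qed.

(** With [e = expi t] and [b = e v], the coordinate [b - b^* p] becomes [2 e Re v], the shape
    required in the second statement. *)
Lemma sqrt_unimodular p : sqn p = 1 -> exists t : R, p = - (expi t * expi t).
Proof.
move=> p1; have [|t ht] := @expi_surj (- p); first by rewrite sqnN.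
exists (t / 2); rewrite -expi_double -[2 * _]mulrC divfK ?pnatr_eq0//.
by rewrite -ht opprK.
Qed.

Lemma cball2E z w : cball2 (z, w) <-> n2 z w <= 1.
Proof.
rewrite /cball2/= !normE -!rmorphXn -rmorphD -[1]/((1 : R)%:C%C) lecR.
by split.
Qed.

End Parametrizations.

Theorem theorem3p3 (R : realType) (x a p s : R[i]) :
  [<-> shilov_boundary (@domainF R) (x, a, p, s);

       exists theta x1 x2 x3 x4 : R,
         x1 ^+ 2 + x2 ^+ 2 + x3 ^+ 2 + x4 ^+ 2 = 1 /\
         (x, a, p, s) =
           (expi theta * (x3 +i* x4)%C,
            - (expi theta * (x3 -i* x4)%C),
            - expi (2 * theta),
            2 * expi theta * (x2%:C)%C);

       exists z w eta : R[i],
         [/\ cball2 (z, w), `|eta| = 1 &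
             (x, a, p, s) = (z^*, - (eta * z), - eta, w + w^* * eta)];

       shilov_boundary (@tetrablock R) (x, a, p) /\
       exists w : R[i], cball2 (x, w) /\ s = w - w^* * p].
Proof.
rewrite (shilov_boundaryE (domainF_shilov R)).
rewrite (shilov_boundaryE (tetrablock_shilov R)).
tfae.
- move=> /phiF_unit4[x' [b [p' [ab p1 [ex ea ep es]]]]]; subst x' p' a s.
  have [t pt] := sqrt_unimodular p1.
  have ee := expi_conj t; set e := expi t in pt ee.
  have div_e z : exists y, z = e * y by exists (e^* * z); rewrite mulrA ee mul1r.
  have [u xu] := div_e x; have [v bv] := div_e b.
  have uv : n2 u v = 1.
    have e1 : sqn e = 1 by exact: sqn_expi.
    by move: ab; rewrite xu bv /n2 !sqnM e1 !mul1r.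
  (* [x1 = Im v] occurs only in the equation of the sphere, as [s] depends on [Re v] alone. *)
  exists t, (Im v), (Re v), (Re u), (Im u); split.
    by rewrite -uv /n2 !sqnRI; ring.
  have uE : (Re u +i* Im u)%C = u by case: (u).
  have ujE : (Re u -i* Im u)%C = u^* by case: (u).
  rewrite expi_double -/e uE ujE -pt -xu; congr (_, _, _, _).
    rewrite pt xu !conjE.
    have -> : e^* * u^* * - (e * e) = - (e * u^* * (e * e^*)) by ring.
    by rewrite ee mulr1.
  rewrite pt bv !conjE.
  have -> : e * v - e^* * v^* * - (e * e) = e * v + e * v^* * (e * e^*) by ring.
  rewrite ee mulr1 -mulrDr addJ rmorphM rmorph_nat; ring.
- move=> [t [x1 [x2 [x3 [x4 [h [-> -> -> ->]]]]]]].
  have ee := expi_conj t; set e := expi t in ee *.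
  (* As [eta = e^2], the part [x1] drops out of [w + w^* eta]. *)
  exists (e * (x3 +i* x4)%C)^*, (e * (x2 +i* x1)%C), (e * e).
  have e1 : sqn e = 1 by exact: sqn_expi.
  split.
  + by apply/cball2E; rewrite /n2 sqn_conj !sqnM e1 !mul1r !sqnRI/=; lra.
  + rewrite normE; congr (_%:C%C); apply/eqP.
    by rewrite -(@eqrXn2 _ 2) ?normc_ge0// expr1n -[_ ^+ 2]/(sqn _) sqnM e1 mulr1.
  rewrite expi_double -/e conjCK; congr (_, _, _, _).
    rewrite !conjE -[(x3 +i* x4)%C^*]/(x3 -i* x4)%C.
    have -> : e * e * (e^* * (x3 -i* x4)%C) = e * (x3 -i* x4)%C * (e * e^*) by ring.
    by rewrite ee mulr1.
  set v := (x2 +i* x1)%C; have vx : x2 = Re v by [].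
  rewrite !conjE.
  have -> : e^* * v^* * (e * e) = e * v^* * (e * e^*) by ring.
  rewrite ee mulr1 -mulrDr addJ vx rmorphM rmorph_nat; ring.
- move=> [z [w [eta [/cball2E zw eta1 [-> -> -> ->]]]]].
  have se : sqn eta = 1.
    by rewrite /sqn; move: eta1; rewrite normE => -[->]; rewrite expr1n.
  split.
    apply/phiE_unit4; exists z^*, (- eta); rewrite sqn_conj sqnN conjCK; split=> //.
      by apply: le_trans zw; rewrite lerDl sqn_ge0.
    by congr (_, _, _); ring.
  exists w; split; last by ring.
  by apply/cball2E; rewrite /n2 sqn_conj.
- move=> [/phiE_unit4[x' [p' [_ p1 [ex ea ep]]]] [w [/cball2E xw es]]].
  subst x' p' a s.
  apply/phiF_unit4.
  have [t pt] := sqrt_unimodular p1.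
  have ee := expi_conj t; set e := expi t in pt ee.
  have e1 : sqn e = 1 by exact: sqn_expi.
  have [v we] : exists v, w = e * v by exists (e^* * w); rewrite mulrA ee mul1r.
  (* The pair [(x, w)] lies only in the ball, but [s] sees [w] through [Re v] alone. Replacing
     [Im v] by the square root of [r] moves the pair to the sphere without changing [s]. *)
  pose r := 1 - sqn x - Re v ^+ 2.
  have r0 : 0 <= r.
    have : sqn w = sqn v by rewrite we sqnM e1 mul1r.
    have := sqr_ge0 (Im v); move: xw; rewrite /n2 /r => h1 h2.
    rewrite (sqnRI v) => h3; lra.
  pose v' : R[i] := (Re v +i* Num.sqrt r)%C.
  exists x, (e * v'), p; split=> //.
    by rewrite /n2 sqnM e1 mul1r (sqnRI v')/= sqr_sqrtr// /r; ring.
  have twist y : e * y - (e * y)^* * p = e * (2 * Re y)%:C%C.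
    rewrite -addJ pt !conjE.
    have -> : e * y - e^* * y^* * - (e * e) = e * y + e * y^* * (e * e^*) by ring.
    by rewrite ee; ring.
  by rewrite we !twist.
Qed.
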